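(* Let $A=\{1<2<3<\cdots\}$ and $\bar A=\{\bar1<\bar2<\cdots\}$, totally ordered so that every element of $\bar A$ exceeds every element of $A$. Let $\beta\leq_c\alpha$ be compositions, $\tau_o$ an SSRCT of shape $\alpha/\!\!/\beta$ with entries in $A$, $\bar\tau$ an SSRCT of straight shape $\beta$ with entries in $\bar A$, and $\tau$ the SSRCT of straight shape $\alpha$ obtained by filling the inner shape of $\tau_o$ according to $\bar\tau$. Let $i\geq1$ be such that $\widetilde\alpha$ has an addable node in column $i$, let $T=\rho(\tau)$, and let $j$ be the greatest integer with $1\leq j\leq i-1$ such that the entry moving horizontally from column $j$ to column $j+1$ during the computation of $\mathrm{jdt}_i(T)$ belongs to $\bar A$ ($j=0$ if there is none). Let $\gamma=\mu_i(\tau)$. Then the entries of $\gamma$ belonging to $\bar A$ form an SSRCT of shape $u_{j+1}(\beta)/\!\!/(1)$, and the entries of $\gamma$ belonging to $A$ form an SSRCT of shape $u_i(\alpha)/\!\!/u_{j+1}(\beta)$, which is independent of the choice of $\bar\tau$.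
   Context: All fillings take values in a totally ordered alphabet. Compositions are drawn as reverse composition diagrams: row $r$ from the top has $\alpha_r$ left-justified boxes; $\widetilde\alpha$ is the sorted partition. Define $\alpha\lessdot_c\beta$ iff $\beta=(1,\alpha_1,\ldots,\alpha_l)$ or $\beta$ is obtained by adding $1$ to a part $\alpha_k$ with $\alpha_s\neq\alpha_k$ for all $s<k$; $\leq_c$ is the reflexive transitive closure. For $\beta\leq_c\alpha$, $\alpha/\!\!/\beta$ is $\alpha$ with the boxes of $\beta$ removed, $\beta$ placed left-justified in the last $l(\beta)$ rows of $\alpha$. An SSRCT of shape $\alpha/\!\!/\beta$ is a filling of $\alpha/\!\!/\beta$ with rows weakly decreasing left to right, first-column entries strictly increasing top to bottom, and for rows $r<s$ and column $c$ with $(s,c+1)\in\alpha/\!\!/\beta$: if $(r,c)\in\beta$ or $\tau(r,c)\geq\tau(s,c+1)$ then $(r,c+1)\in\beta$ or both $(r,c+1)\in\alpha/\!\!/\beta$ and $\tau(r,c+1)>\tau(s,c+1)$. SSRTs (French convention, rows bottom to top): fillings of a partition weakly decreasing along rows, strictly decreasing up columns. $\rho(\tau)$ sorts each column of $\tau$ decreasingly from bottom to top, bottom-justified. $\mathrm{jdt}_i(T)$: starting from the addable node in column $i$, the empty box $(p,q)$ is filled from whichever of $(p-1,q),(p,q-1)$ holds the smaller entry (ties to $(p-1,q)$), until the empty box is $(1,1)$. Operators: $\mathfrak{d}_t(\alpha)$ subtracts $1$ from the rightmost part equal to $t$ (omitting a $0$; $0$ if none); $\mathfrak{v}_{[t-1]}=\mathfrak{d}_1\cdots\mathfrak{d}_{t-1}$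 ($\mathfrak{d}_{t-1}$ first; $\mathfrak{v}_{[0]}=\mathrm{id}$); $a_t$ appends a part $t$; $u_t=a_t\mathfrak{v}_{[t-1]}$. $\phi_{t+1}$ ($t\geq1$) on an SSRCT $\tau$ of straight shape with a part equal to $t$ (entries outside the shape count as $0$, smaller than all letters): $r_1$ is the largest row index of a part equal to $t$; for $m\geq2$, $r_m$ is the largest $r<r_{m-1}$ with $\tau(r,t)>\tau(r_{m-1},t)\geq\tau(r,t+1)$, ending at $r_k$; $\phi_{t+1}(\tau)$ places, for $m=k,\ldots,2$, the original $\tau(r_{m-1},t)$ into $(r_m,t)$ and deletes box $(r_1,t)$ (and its row if empty); $\tau(r_k,t)$ exits. $\mu_i(\tau)$: if $i=1$, $\tau'=\tau$, $H=\varnothing$; else $\tau'=\phi_2(\cdots\phi_i(\tau)\cdots)$ and $H$ the multiset of the $i-1$ exiting entries; with $\tau'$ of shape $(\gamma_1,\ldots,\gamma_s)$, $\mu_i(\tau)$ is the filling of $(\gamma_1,\ldots,\gamma_s,i)/\!\!/(1)$ with first $s$ rows $\tau'$ and last row an empty first box followed by $H$ in decreasing order. ''The entries in $\bar A$ form an SSRCT of shape $X/\!\!/(1)$'' and ''the entries in $A$ form an SSRCT of shape $Y/\!\!/X$'' mean that the boxes with entries in $\bar A$ together with the empty box form the diagram $X$ placed as an inner shape, and the remaining boxes form $Y/\!\!/X$. *)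

(* Defs.v *)
From Stdlib Require Relations.
From mathcomp Require Import all_boot.
Set Implicit Arguments. Unset Strict Implicit. Unset Printing Implicit Defensive.

(* ---------- Alphabet ----------
   A letter is a pair (b, n): (false, n) is n in A = {1<2<...},
   (true, n) is \bar n in \bar A.  Order: lexicographic with A < \bar A.
   The pair (false, 0) is the "0" (entry outside the shape), smaller than
   every letter. *)
Definition letter := (bool * nat)%type.
Definition zero : letter := (false, 0).
Definition barred (x : letter) : bool := x.1.
Definition is_letter (x : letter) : bool := 0 < x.2.
Definition lel (x y : letter) : bool :=
  if x.1 == y.1 then x.2 <= y.2 else y.1.
Definition ltl (x y : letter) : bool := ~~ lel y x.

Definition composition (a : seq nat) : bool := all (fun x => 0 < x) a.
Definition part (a : seq nat) (r : nat) : nat := nth 0 a r.-1.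

Definition covc (a b : seq nat) : Prop :=
  b = 1 :: a \/
  exists k, k < size a /\ b = set_nth 0 a k (nth 0 a k).+1 /\
            forall s, s < k -> nth 0 a s != nth 0 a k.
Definition leqc (b a : seq nat) : Prop := Relations.Relation_Operators.clos_refl_trans (seq nat) covc b a.

(* ---------- Cells (row r from top, column c, both 1-indexed) ---------- *)
Definition in_shape (a : seq nat) (r c : nat) : bool :=
  (0 < r <= size a) && (0 < c <= part a r).
Definition in_inner (a b : seq nat) (r c : nat) : bool :=
  (size a - size b < r <= size a) && (0 < c <= part b (r - (size a - size b))).
Definition in_skew (a b : seq nat) (r c : nat) : bool :=
  in_shape a r c && ~~ in_inner a b r c.

Definition filling := nat -> nat -> letter.

(* SSRCT of shape a // b (a filling only matters on the cells of a // b). *)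
Definition ssrct (a b : seq nat) (f : filling) : Prop :=
  [/\ composition a, composition b, leqc b a &
   (forall r c, in_skew a b r c -> is_letter (f r c))] /\
  [/\
   (forall r c, in_skew a b r c -> in_skew a b r c.+1 -> lel (f r c.+1) (f r c)),

   (forall r s, r < s -> in_skew a b r 1 -> in_skew a b s 1 -> ltl (f r 1) (f s 1))
 & (forall r s c, 0 < c -> r < s -> in_skew a b s c.+1 ->
      (in_inner a b r c || (in_skew a b r c && lel (f s c.+1) (f r c))) ->
      (in_inner a b r c.+1 || (in_skew a b r c.+1 && ltl (f s c.+1) (f r c.+1))))].

Definition glue (a b : seq nat) (to tb : filling) : filling :=
  fun r c => if in_inner a b r c then tb (r - (size a - size b)) c else to r c.

(* d_t : None stands for the value 0 *)
Definition dop (t : nat) (a : seq nat) : option (seq nat) :=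
  let rs := [seq r <- iota 1 (size a) | part a r == t] in
  if rs is [::] then None else
  let r1 := last 0 rs in
  Some (if t.-1 == 0 then take r1.-1 a ++ drop r1 a else set_nth 0 a r1.-1 t.-1).
Fixpoint vdown (n : nat) (a : seq nat) : option (seq nat) :=
  match n with 0 => Some a | n'.+1 => obind (vdown n') (dop n a) end.
Definition uop (t : nat) (a : seq nat) : option (seq nat) :=
  omap (fun b => rcons b t) (vdown t.-1 a).

(* addable node in column i of the partition sorting alpha *)
Definition collen (a : seq nat) (q : nat) : nat := count (fun x => q <= x) a.
Definition addable (a : seq nat) (i : nat) : bool :=
  (i == 1) || ((1 < i) && (collen a i < collen a i.-1)).

(* ---------- rho and jeu de taquin (French SSRT, row p from bottom) ---- *)
Definition colseq (a : seq nat) (f : filling) (q : nat) : seq letter :=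
  [seq f r q | r <- iota 1 (size a) & q <= part a r].
Definition rho (a : seq nat) (f : filling) : filling :=
  fun p q => nth zero (sort (fun x y => lel y x) (colseq a f q)) p.-1.

(* list of horizontal moves (source column, moving entry) of jdt from (p,q) *)
Fixpoint jdt_hmoves (T : filling) (n p q : nat) : seq (nat * letter) :=
  match n with
  | 0 => [::]
  | n'.+1 =>
    if (p == 1) && (q == 1) then [::]
    else if p == 1 then (q.-1, T 1 q.-1) :: jdt_hmoves T n' 1 q.-1
    else if q == 1 then jdt_hmoves T n' p.-1 1
    else if lel (T p.-1 q) (T p q.-1) then jdt_hmoves T n' p.-1 q
    else (q.-1, T p q.-1) :: jdt_hmoves T n' p q.-1
  end.
Definition jdt_moves (a : seq nat) (T : filling) (i : nat) : seq (nat * letter) :=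
  let p0 := (collen a i).+1 in jdt_hmoves T (p0 + i) p0 i.
Definition jbar (moves : seq (nat * letter)) : nat :=
  foldr maxn 0 [seq m.1 | m <- moves & barred m.2].

Definition ext (a : seq nat) (f : filling) : filling :=
  fun r c => if in_shape a r c then f r c else zero.
Definition nextr (F : filling) (t rp : nat) : option nat :=
  let cands := [seq r <- iota 1 rp.-1 |
                 ltl (F rp t) (F r t) && lel (F r t.+1) (F rp t)] in
  if cands is [::] then None else Some (last 0 cands).
Fixpoint chain (F : filling) (t n rp : nat) : seq nat :=
  match n with
  | 0 => [::]
  | n'.+1 => if nextr F t rp is Some r then r :: chain F t n' r else [::]
  end.

Definition state := (seq nat * filling)%type.

(* phi t = phi_{t+1}: returns the new state and the exiting entry *)
Definition phi (t : nat) (st : state) : state * letter :=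
  let a := st.1 in
  let F := ext a st.2 in
  let r1 := last 0 [seq r <- iota 1 (size a) | part a r == t] in
  let ch := chain F t r1 r1 in
  let rs := r1 :: ch in
  let f' : filling := fun r c =>
    if (c == t) && (r \in ch) then F (nth 0 rs (index r ch)) t else F r c in
  let a' := if t.-1 == 0 then take r1.-1 a ++ drop r1 a
            else set_nth 0 a r1.-1 t.-1 in
  let f'' : filling := fun r c =>
    f' (if (t.-1 == 0) && (r1 <= r) then r.+1 else r) c in
  ((a', f''), F (last r1 ch) t).

Fixpoint phis (t : nat) (st : state) : state * seq letter :=
  match t with
  | 0 => (st, [::])
  | t'.+1 => let (st1, x) := phi t st in
             let (st2, H) := phis t' st1 in (st2, x :: H)
  end.

(* mu_i : a filling of shape (gamma_1,...,gamma_s, i) // (1); returned as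
   the outer shape together with the filling *)
Definition mu (i : nat) (st : state) : state :=
  let (st', H) := phis i.-1 st in
  let s := size st'.1 in
  let Hs := sort (fun x y => lel y x) H in
  (rcons st'.1 i,
   fun r c => if r <= s then st'.2 r c else nth zero Hs (c - 2)).

Definition Apart (g : state) (r c : nat) : option letter :=
  if in_skew g.1 [:: 1] r c && ~~ barred (g.2 r c) then Some (g.2 r c) else None.

(* Main.v *)
(* Each phi_{t+1} acts on two adjacent columns c = column t and d = column t+1. Say that row r
   straddles y when d_r <= y < c_r. The triple condition implies that the chain r_1, r_2, ... of
   phi_{t+1} is obtained by taking r_1 = the bottommost row straddling 0 and r_{m+1} = the
   bottommost row straddling the entry of r_m, until no row straddles it. Consequently, for every
   level z below the exiting entry x, the set of boxes with entries > z loses exactly one box of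
   column t, in its last row of length t; for z >= x it is unchanged. Taking z = 0 and z the cut
   between A and \bar A, this says that alpha, respectively beta (if x is barred), undergoes d_t.

   No row straddles x, while every y < x is straddled: in terms of the numbers of entries
   exceeding a level in columns t and t+1, this is also what characterises the entry moving
   horizontally from column t to column t+1 in the jeu de taquin, so the exiting entries are the
   horizontally moving ones, and they increase. Hence beta undergoes d_j, ..., d_1.

   Filling the empty box of gamma with a letter larger than all others gives an SSRCT of straight
   shape; any SSRCT cut at a level yields SSRCTs of the two resulting shapes, and the order
   relation between these shapes holds because removing a smallest box undoes a cover. *)
Require Import Defs.
From mathcomp Require Import all_boot.
From mathcomp Require Import zify.
Set Implicit Arguments. Unset Strict Implicit. Unset Printing Implicit Defensive.

(** * The total order on letters and its reduction to arithmetic *)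

Lemma lel_refl x : lel x x.
Proof. by case: x => [b n]; rewrite /lel eqxx /=. Qed.

Lemma lel_anti x y : lel x y -> lel y x -> x = y.
Proof. case: x y => [[] m] [[] n]; rewrite /lel //= => h1 h2; congr (_, _); lia. Qed.

Lemma lel_trans y x z : lel x y -> lel y z -> lel x z.
Proof. case: x y z => [[] m] [[] n] [[] p]; rewrite /lel //=; lia. Qed.

Lemma lel_total x y : lel x y || lel y x.
Proof. case: x y => [[] m] [[] n]; rewrite /lel //=; lia. Qed.

Lemma lel0 x : lel zero x.
Proof. by case: x => [[] m]. Qed.

Lemma eq_lel x y : x = y -> lel x y && lel y x.
Proof. by move=> ->; rewrite lel_refl. Qed.

(* Makes order goals between letters accessible to lia. *)
Lemma letter_rank (L : seq letter) :
  exists f : letter -> nat, {in L &, forall x y, lel x y = (f x <= f y)}.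
Proof.
exists (fun x => count (fun y => ltl y x) L) => x y xL yL.
apply/idP/idP => [xy|]; first by apply: sub_count => z; apply: contra; apply: lel_trans.
apply: contraLR => nxy; rewrite -ltnNge.
have yx : lel y x by move: (lel_total x y); rewrite (negbTE nxy).
(* Splitting [y] off the list makes the inequality strict: [y] is counted below [x] but not below
   itself. *)
rewrite (permP (perm_to_rem yL)) [in X in _ < X](permP (perm_to_rem yL)) /=.
have -> : ltl y y = false by rewrite /ltl lel_refl.
rewrite (_ : ltl y x = true) // ltnS add0n; apply: sub_count => z.
by apply: contra => xz; apply: lel_trans xz.
Qed.

Ltac letter_vars H0 L :=
  match goal with
  | v : ?T |- _ => unify T letter;
      lazymatch L with context [cons v _] => fail | _ => generalize (H0 v); letter_vars H0 (cons (v : letter) L) end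
  | _ => clear H0; let f := fresh in let Hf := fresh in
      have [f Hf] := letter_rank L;
      rewrite ?Hf ?inE ?eqxx ?orbT //; clear Hf
  end.

(** Letter equations become pairs of inequalities, unquantified order facts move into the goal, and
    compound letters are abstracted to variables; a rank on the resulting finite list turns [lel]
    into [<=]. [zero] is abstracted too, remembered only as a least element. *)
Ltac letter_order :=
  repeat match goal with
  | H : @eq ?T _ _ |- _ => lazymatch T with letter => idtac | (bool * nat)%type => idtac end;
     let H1 := fresh in
     have H1 := eq_lel H; clear H; revert H1
  end;
  repeat match goal with
  | H : ?P |- _ => lazymatch type of P with Prop => idtac end;
      lazymatch P with
      | forall x : letter, _ => clear H
      | forall x : nat, _ => clear H
      | context [lel] => revert H
      | context [ltl] => revert H
      | _ => clear H end
  end;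
  rewrite /ltl;
  let z0 := fresh in let Hz0 := fresh in
  generalize lel0; generalize zero; intros z0 Hz0;
  repeat match goal with
  | |- context [lel ?x ?y] =>
      first [ assert_fails (is_var x); generalize x; intro
            | assert_fails (is_var y); generalize y; intro ]
  end;
  letter_vars Hz0 (@nil letter); lia.

(** * The chain in two adjacent columns *)

Section Slide.
Variables c d : nat -> letter.
Hypothesis dc : forall r, lel (d r) (c r).
Hypothesis trip : forall r s, r < s -> ltl zero (d s) -> lel (d s) (c r) -> ltl (d s) (d r).
Hypothesis cinj : forall r s, c r = c s -> ltl zero (c r) -> r = s.

Definition straddles (y : letter) (r : nat) : bool := lel (d r) y && ltl y (c r).
Definition bottommost (y : letter) (r : nat) : Prop :=
  straddles y r /\ forall s, r < s -> ~~ straddles y s.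

(** A row [s] below [r] with [d s <= c r < c s] does not straddle [y], so [d s > y >= d r], against
    the triple condition. Hence the next chain row lies strictly above [r]. *)
Lemma bottommost_up y r s : bottommost y r -> r <= s -> ~~ straddles (c r) s.
Proof.
move=> [/andP[dry ycr] hb]; rewrite leq_eqVlt => /orP[/eqP<-|rs].
  by rewrite /straddles; letter_order.
apply/negP => /andP[dsc csc]; move: (hb s rs); rewrite /straddles => nst.
have := trip rs; letter_order.
Qed.

(** [y] is the letter pushed into row [r], and each entry pushed out enters the next row of [ch];
    the last one exits. Allowing any [y], not only [zero], makes the chain of [phi] accessible to
    induction. *)
Inductive slide : letter -> nat -> seq nat -> Prop :=
| slide_end y r : bottommost y r -> (forall s, ~~ straddles (c r) s) -> slide y r [::]
| slide_step y r r' ch : bottommost y r -> slide (c r) r' ch -> slide y r (r' :: ch).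

Fixpoint slid (y : letter) (r : nat) (ch : seq nat) (s : nat) : letter :=
  if s == r then y else if ch is r' :: ch' then slid (c r) r' ch' s else c s.

Lemma slide_bottommost y r ch : slide y r ch -> bottommost y r.
Proof. by case. Qed.

Lemma slide_cons_inv y r r' ch : slide y r (r' :: ch) -> bottommost y r /\ slide (c r) r' ch.
Proof. by move=> h; inversion h. Qed.

Lemma slide_lt y r ch : slide y r ch -> ltl y (c (last r ch)) /\ lel (c r) (c (last r ch)).
Proof.
elim=> {y r ch} [y r [/andP[_ h] _] _|y r r' ch [/andP[_ h] _] _ [h1 h2]] /=.
  split=> //; letter_order.
by split; letter_order.
Qed.

Lemma slide_exit y r ch : slide y r ch -> forall s, ~~ straddles (c (last r ch)) s.
Proof. by elim. Qed.

Lemma slide_dec y r ch : slide y r ch -> forall s, s \in ch -> s < r.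
Proof.
elim=> // {y r ch} y r r' ch hb hs IH s.
have lt_r'r : r' < r.
  rewrite ltnNge; apply/negP => le_rr'.
  by move: (bottommost_up hb le_rr'); case: (slide_bottommost hs) => ->.
by rewrite inE => /orP[/eqP->//|/IH sr']; apply: ltn_trans lt_r'r.
Qed.

Lemma slid_notin y r ch s : s \notin r :: ch -> slid y r ch s = c s.
Proof.
elim: ch y r => [|r' ch IH] y r /=; rewrite inE; first by move=> /negbTE ->.
by rewrite negb_or => /andP[/negbTE -> /IH].
Qed.

(** Connects the recursive description of the new column with the lookup by [index] that [phi]
    uses. *)
Lemma slid_in y r ch s : slide y r ch -> s \in ch ->
  slid y r ch s = c (nth 0 (r :: ch) (index s ch)).
Proof.
move=> hs; elim: hs s => // {y r ch} y r r' ch hb hs IH s sin /=.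
have := slide_dec (slide_step hb hs) sin; rewrite ltn_neqAle => /andP[/negbTE -> _].
move: sin; rewrite inE eq_sym => /orP[/eqP<-|sin].
  by rewrite eqxx; case: (ch) => [|? ?] /=; rewrite eqxx.
have := slide_dec hs sin; rewrite ltn_neqAle eq_sym => /andP[/negbTE -> _].
exact: IH.
Qed.

Lemma slid_head y r ch : slid y r ch r = y.
Proof. by case: ch => [|? ?] /=; rewrite eqxx. Qed.

(** An entry that moves goes up, and the row it leaves receives a smaller one; the only other new
    value is [y] in row [r]. *)
Lemma slid_origin y r ch : slide y r ch -> forall s,
  slid y r ch s = c s \/ s = r \/
  exists2 s', s < s' & slid y r ch s = c s' /\ ltl (slid y r ch s') (c s').
Proof.
elim=> {y r ch} [y r hb _|y r r' ch hb hs IH] s /=.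
  by case: eqP; [right; left|left].
case: eqP => [->|/eqP nsr]; first by right; left.
have dec := slide_dec (slide_step hb hs).
have [h|[->|[s' lt_ss' [e h]]]] := IH s; first by left.
  right; right; exists r; first by apply: dec; rewrite mem_head.
  rewrite slid_head eqxx; split=> //; by case: hb => /andP[].
right; right; exists s' => //; rewrite e; case: eqP => [e'|_] //.
by split=> //; rewrite e'; case: hb => /andP[].
Qed.

Lemma slid_le y r ch : slide y r ch -> forall s, lel (slid y r ch s) (c s).
Proof.
elim=> {y r ch} [y r hb _|y r r' ch hb hs IH] s /=; case: eqP => [->|_] //.
- case: hb => /andP[_]; letter_order.
- letter_order.
- case: hb => /andP[_]; letter_order.
Qed.

Lemma slid_ge y r ch : slide y r ch -> forall s, lel (d s) (slid y r ch s).
Proof.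
elim=> {y r ch} [y r hb _|y r r' ch hb hs IH] s /=; case: eqP => [->|_] //.
- by case: hb => /andP[].
- by case: hb => /andP[].
Qed.

(** The old and new entries of the chain rows are all at most the exiting entry. *)
Lemma slid_high y r ch : slide y r ch -> forall z s,
  lel (c (last r ch)) z -> ltl z (slid y r ch s) = ltl z (c s).
Proof.
elim=> {y r ch} [y r hb _|y r r' ch hb hs IH] z s /= hz; case: eqP => [->|_] //.
- case: hb => /andP[_ h] _; apply/idP/idP; letter_order.
- have [_ /= h2] := slide_lt (slide_step hb hs); have [/andP[_ h] _] := hb.
  by clear -hz h h2; apply/idP/idP; letter_order.
- exact: IH.
Qed.

Lemma slid_low y r ch : slide y r ch -> forall z s,
  ltl z y -> ltl z (slid y r ch s) = ltl z (c s).
Proof.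
elim=> {y r ch} [y r hb _|y r r' ch hb hs IH] z s /= hz; case: eqP => [->|_] //.
- case: hb => /andP[_ h] _; apply/idP/idP; letter_order.
- case: hb => /andP[_ h] _; apply/idP/idP; letter_order.
- by apply: IH; case: hb => /andP[_ h] _; letter_order.
Qed.

(** A lower row [s] straddling [z] but not [y] has [y < d s <= z < c r], so the triple condition
    gives [d s < d r <= y]. *)
Lemma bottommost_between y z r : bottommost y r -> lel y z -> ltl z (c r) -> bottommost z r.
Proof.
move=> [/andP[h1 h2] h3] hy hz; split; first by rewrite /straddles; letter_order.
move=> s rs; apply/negP => /andP[h4 h5]; have := h3 s rs; rewrite /straddles => h6.
have h7 : ltl y (d s) by letter_order.
have : ltl (d s) (d r) by apply: trip => //; clear h3; letter_order.
by clear -h1 h7; letter_order.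
Qed.

(** The letters pushed along the chain increase, so [z] lies between exactly one of them and the
    entry it replaces. In that row the entry drops from above [z] to at most [z]; every other
    replacement stays on one side of [z]. *)
Lemma slid_crossing y r ch : slide y r ch -> forall z, lel y z -> ltl z (c (last r ch)) ->
  exists s y', [/\ bottommost z s, bottommost y' s, slid y r ch s = y',
    lel y' z & ltl z (c s)] /\
    forall s', s' != s -> ltl z (slid y r ch s') = ltl z (c s').
Proof.
elim=> {y r ch} [y r hb _|y r r' ch hb hs IH] z /= hy hz.
- exists r, y; rewrite eqxx; split; last by move=> s' /negbTE ->.
  by split=> //; apply: bottommost_between hb _ _.
have [hzr|hzr] := boolP (ltl z (c r)).
  exists r, y; rewrite eqxx; split.
    by split=> //; apply: bottommost_between hb _ _.
  by move=> s' /negbTE ->; apply: slid_low.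
have hrz : lel (c r) z by letter_order.
have [s [y' [[h1 h2 h3 h4 h5] h6]]] := IH z hrz hz.
exists s, y'; have /negbTE nsr : s != r by apply/eqP => e; move: h5; rewrite e; letter_order.
rewrite nsr; split=> // s' ns; case: eqP => [->|_]; last exact: h6.
by apply/idP/idP; letter_order.
Qed.

(** Here [b] is the column to the left of [c]. Only the row in which the slide crosses the level of
    the lower entry could violate the triple condition, and there the choice of bottommost rows
    prevents it. *)
Lemma slid_trip b r ch : (forall s, lel (c s) (b s)) ->
  (forall s s', s < s' -> ltl zero (c s') -> lel (c s') (b s) -> ltl (c s') (c s)) ->
  slide zero r ch ->
  forall s s', s < s' -> ltl zero (slid zero r ch s') -> lel (slid zero r ch s') (b s) ->
    ltl (slid zero r ch s') (slid zero r ch s).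
Proof.
move=> cb tripb hs s s' lt_ss' pos le_b.
set u := slid zero r ch s' in pos le_b *.
(* Entries only move up, so [u] was in row [s'] or lower before the slide. *)
have : exists2 t, s < t & u = c t.
  have [e|[e|[t lt_s't [e _]]]] := slid_origin hs s'; first by exists s'.
    by move: pos; rewrite /u e slid_head.
  by exists t => //; apply: ltn_trans lt_s't.
case=> t lt_st ut.
have ucs : ltl u (c s) by rewrite ut; apply: (tripb _ t); rewrite -?ut.
have [hx|hx] := boolP (ltl u (c (last r ch))); last first.
  by rewrite (slid_high hs) //; letter_order.
have h0u : lel zero u by letter_order.
have [s0 [y' [[h1 h2 h3 h4 h5] h6]]] := slid_crossing hs h0u hx.
(* Outside the crossing row, the comparison with [u] is the same before and after the slide. *)
have [e|ns] := eqVneq s s0; last by rewrite h6.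
rewrite -{s0}e in h1 h2 h3 h4 h5 h6.
have e' : u = c s'.
  have ns' : s' != s by rewrite neq_ltn lt_ss' orbT.
  have := h6 s' ns'; rewrite -/u => h7.
  by apply: lel_anti; [exact: slid_le|move: h7; clear; rewrite /u; letter_order].
(* If row [s] had received [u], injectivity would make [s'] the row it came from; but that row keeps
   its entry. *)
have ny' : y' != u.
  apply/eqP => y'u.
  have [h|[h|[q _ [h8 h9]]]] := slid_origin hs s.
  - by move: h5; rewrite -h h3 y'u; clear; letter_order.
  - by move: pos; rewrite -y'u -h3 h slid_head; clear; letter_order.
  - have qs' : q = s' by apply: cinj; rewrite -h8 h3 y'u.
    by move: h9; rewrite qs' -/u -e'; clear; letter_order.
have lt_y'u : ltl y' u.
  by apply/negP => h; case/eqP: ny'; apply: lel_anti.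
(* Row [s'] lies below the bottommost row straddling [y'], so [d s' > y']; the triple condition then
   gives [d s' < d s <= y']. *)
case: h2 => /andP[h7 h8] /(_ s' lt_ss') /negP[].
rewrite /straddles -e' lt_y'u andbT.
apply/negPn/negP => nd; have h9 : ltl (d s') (d s).
  by apply: trip => //; have := dc s'; rewrite -?e'; letter_order.
by clear -h9 h7 nd; letter_order.
Qed.

Lemma slid_last_lt y r ch : slide y r ch ->
  ltl (slid y r ch (last r ch)) (c (last r ch)).
Proof.
elim=> {y r ch} [y r [/andP[_ h] _] _|y r r' ch hb hs IH] /=; first by rewrite eqxx.
case: eqP => [e|_] //; have [h _] := slide_lt (slide_step hb hs); exact: h.
Qed.

(** If the new entry exceeds the exiting one, so does the old, and the row, not straddling the
    exiting entry, has its [d] above it as well. Equality would force the row that the entry has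
    left, where the new entry is smaller. *)
Lemma slid_no_straddle r ch : slide zero r ch -> forall s,
  lel (c (last r ch)) (slid zero r ch s) -> ltl (c (last r ch)) (d s).
Proof.
move=> hs s hx; have [x0 _] := slide_lt hs.
have hc := slid_le hs s; have hex := slide_exit hs s.
have [h|h] := boolP (ltl (c (last r ch)) (slid zero r ch s)).
  by move: hex; rewrite /straddles; letter_order.
have hh : ~~ ltl (c (last r ch)) (c s) by rewrite -(slid_high hs) // lel_refl.
have es : s = last r ch.
  by apply: cinj; [apply: lel_anti|]; letter_order.
by move: hx; rewrite es; have := slid_last_lt hs; letter_order.
Qed.

End Slide.

(** * Row lengths and removal of boxes *)

(** [part a 0] is the first part, because of [.-1]; here the fictitious row [0] has length [0], so
    that no bounds on rows are needed. *)
Definition rowlen (a : seq nat) (r : nat) : nat := if r is r'.+1 then nth 0 a r' else 0.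

Lemma rowlen_part a r : 0 < r -> part a r = rowlen a r.
Proof. by case: r. Qed.

Lemma rowlen_size a r : 0 < rowlen a r -> 0 < r <= size a.
Proof. by case: r => //= r; apply: contraTT; rewrite -leqNgt => h; rewrite nth_default. Qed.

Lemma rowlen_gt0 a r : composition a -> 0 < r <= size a -> 0 < rowlen a r.
Proof. by move=> /all_nthP h; case: r => //= r; apply: h. Qed.

Lemma in_shapeE a r c : in_shape a r c = (0 < c <= rowlen a r).
Proof.
rewrite /in_shape; case: r => [|r] /=; first by case: c.
rewrite /part /=; case: ltnP => //= h; rewrite nth_default //; by case: c.
Qed.

Lemma in_innerE a b r c : size b <= size a ->
  in_inner a b r c = (0 < c <= rowlen b (r - (size a - size b))).
Proof.
move=> hs; rewrite /in_inner; case: ltnP => /= [h|].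
  rewrite rowlen_part ?subn_gt0 //; case: (leqP r) => //= h2.
  rewrite (_ : rowlen b _ = 0); first by case: c.
  apply/eqP; rewrite -leqn0 leqNgt; apply/negP => /rowlen_size; lia.
by rewrite -subn_eq0 => /eqP -> /=; case: c.
Qed.

Lemma last_filter_iota (P : pred nat) m n : has P (iota m n) ->
  let r := last 0 (filter P (iota m n)) in
  [/\ P r, m <= r < m + n & forall s, r < s < m + n -> ~~ P s].
Proof.
elim: n => [//|n IH]; rewrite -addn1 iotaD has_cat /= orbF filter_cat last_cat /=.
have [Pn _|nPn] := boolP (P (m + n)); rewrite ?orbF /=.
  by split; [exact: Pn|lia|move=> s; lia].
move=> /IH [h1 h2 h3]; split; [exact: h1|lia|move=> s hs].
have [->//|ns] := eqVneq s (m + n); apply: h3; lia.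
Qed.

Definition remove_box (t r : nat) (a : seq nat) : seq nat :=
  if t.-1 == 0 then take r.-1 a ++ drop r a else set_nth 0 a r.-1 t.-1.
(** Deleting an emptied row is a reindexing: row [s] of the new diagram is row [skip_row t r s] of
    the diagram that still keeps the empty row, whose lengths are given by [shrink_row]. *)
Definition skip_row (t r s : nat) : nat := if (t.-1 == 0) && (r <= s) then s.+1 else s.
Definition shrink_row (t r : nat) (L : nat -> nat) (s : nat) : nat := if s == r then t.-1 else L s.
Definition last_row (L : nat -> nat) (t r : nat) : Prop := L r = t /\ forall s, r < s -> L s <> t.

Lemma last_row_uniq L t r r' : last_row L t r -> last_row L t r' -> r = r'.
Proof.
move=> [h1 h2] [h3 h4]; case: (ltngtP r r') => // h; first by case: (h2 _ h).
by case: (h4 _ h).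
Qed.

Lemma last_row_part (a : seq nat) t : 0 < t -> t \in a ->
  last_row (rowlen a) t (last 0 [seq r <- iota 1 (size a) | part a r == t]).
Proof.
move=> t0 /(nthP 0) [k hk e].
have hh : has (fun r => part a r == t) (iota 1 (size a)).
  by apply/hasP; exists k.+1; [rewrite mem_iota add1n !ltnS hk|rewrite /part /= e].
have [/eqP h1 h2 h3] := last_filter_iota hh; split.
  by rewrite -rowlen_part //; lia.
move=> s hs e'; have /rowlen_size h4 : 0 < rowlen a s by rewrite e'.
have /negP[] := h3 s ltac:(rewrite hs; lia); rewrite rowlen_part ?e' //; lia.
Qed.

Lemma last_row_mem (a : seq nat) t r : 0 < t -> rowlen a r = t -> t \in a.
Proof.
move=> t0 e; have /rowlen_size : 0 < rowlen a r by rewrite e.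
by case: r e => [//|r] /= <- h; apply: mem_nth.
Qed.

Lemma dopE t a r : 0 < t -> last_row (rowlen a) t r -> dop t a = Some (remove_box t r a).
Proof.
move=> t0 h; have ta := last_row_mem t0 (proj1 h).
have e := last_row_uniq h (last_row_part t0 ta).
rewrite /dop; case E: [seq r <- _ | _] => [|x s].
  move: e; rewrite E /= => r0; move: h => [h _]; move: h; rewrite r0 /= => tt.
  by rewrite -tt in t0.
by rewrite -E -e.
Qed.

Lemma rowlen_remove t a r s : 0 < t -> rowlen a r = t ->
  rowlen (remove_box t r a) s = shrink_row t r (rowlen a) (skip_row t r s).
Proof.
move=> t0 e; have /rowlen_size/andP[r0 hr] : 0 < rowlen a r by rewrite e.
rewrite /remove_box /skip_row /shrink_row; case: ifP => /= ht.
  case: s => [|s] /=; first by rewrite leqNgt r0 /= (ltn_eqF r0).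
  have szt : size (take r.-1 a) = r.-1 by rewrite size_take; case: ifP => //; lia.
  rewrite nth_cat szt; case: (ltnP s r.-1) => h.
    have /negbTE -> : ~~ (r <= s.+1) by lia.
    have /negbTE -> /= : s.+1 != r by lia.
    by rewrite nth_take.
  have -> : r <= s.+1 by lia.
  have /negbTE -> /= : s.+2 != r by lia.
  by rewrite nth_drop; congr nth; lia.
case: s => [|s] /=; first by rewrite (ltn_eqF r0).
by rewrite nth_set_nth /=; case: (r) r0.
Qed.

Lemma size_remove t a r : 0 < t -> rowlen a r = t ->
  size (remove_box t r a) = size a - (t == 1).
Proof.
move=> t0 e; have /rowlen_size/andP[r0 hr] : 0 < rowlen a r by rewrite e.
rewrite /remove_box; case: ifP => ht.
  by rewrite size_cat size_take size_drop; case: ifP; lia.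
by rewrite size_set_nth; lia.
Qed.

Lemma compositionP a : reflect (forall r, 0 < r <= size a -> 0 < rowlen a r) (composition a).
Proof.
apply: (iffP idP) => [ca r|h]; first exact: rowlen_gt0.
by apply/(all_nthP 0) => r hr; apply: (h r.+1).
Qed.

Lemma composition_remove t a r : 0 < t -> rowlen a r = t -> composition a ->
  composition (remove_box t r a).
Proof.
move=> t0 e /compositionP ca; apply/compositionP => s; rewrite size_remove // rowlen_remove //.
have /rowlen_size/andP[r0 hr] : 0 < rowlen a r by rewrite e.
rewrite /shrink_row /skip_row => hs.
set u := (if _ && _ then _ else _).
have hu : 0 < u <= size a by rewrite /u; case: ifP; lia.
case: ifP => h; last exact: ca.
by move: h; rewrite /u; case: ifP; lia.
Qed.

(** * Straight tableaux and the operator phi *)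

(** A straight tableau as a total function that is [zero] outside its diagram; the triple condition
    then needs no membership tests. Row lengths form a function so that a row may be empty for a
    while, as after a slide in column [1]. *)
Record tableau_rows (L : nat -> nat) (F : filling) : Prop := TableauRows {
  tab_letter : forall r c, F r c = zero \/ is_letter (F r c);
  tab_supp : forall r c, ltl zero (F r c) = (0 < c <= L r);
  tab_row0 : L 0 = 0;
  tab_row : forall r c, 0 < c -> lel (F r c.+1) (F r c);
  tab_col1 : forall r s, r < s -> ltl zero (F r 1) -> ltl zero (F s 1) -> ltl (F r 1) (F s 1);
  tab_triple : forall r s c, 0 < c -> r < s -> ltl zero (F s c.+1) ->
    lel (F s c.+1) (F r c) -> ltl (F s c.+1) (F r c.+1) }.

(** The first column increases. In a later column, an equal lower entry would be at most the left
    neighbour of the upper one, and the triple condition would make it strictly smaller. *)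
Lemma tab_inj L F r s c : tableau_rows L F -> 0 < c -> F r c = F s c ->
  ltl zero (F r c) -> r = s.
Proof.
move=> hF; case: c => [//|c] _.
suff wlog_lt r' s' : r' < s' -> F r' c.+1 = F s' c.+1 -> ~~ ltl zero (F r' c.+1).
  move=> e pos; case: (ltngtP r s) => // h.
    by move: (wlog_lt _ _ h e); rewrite pos.
  by move: (wlog_lt _ _ h (esym e)); rewrite -e pos.
move=> lt_rs e; apply/negP => pos.
case: c => [|c] in e pos *.
  have := tab_col1 hF lt_rs pos; rewrite -e => /(_ pos); letter_order.
have := tab_triple hF (c := c.+1) isT lt_rs; rewrite -e => /(_ pos).
by have := tab_row hF r' (c := c.+1) isT => h /(_ h); letter_order.
Qed.

Definition level (z : letter) (F : filling) (M : nat -> nat) : Prop :=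
  forall r c, ltl z (F r c) = (0 < c <= M r).

Section ColumnSlide.
Variables (L : nat -> nat) (F : filling) (t r1 : nat) (ch : seq nat).
Hypotheses (t0 : 0 < t) (hF : tableau_rows L F).
Let c r := F r t.
Let d r := F r t.+1.
Hypothesis hs : slide c d zero r1 ch.

Definition slid_filling : filling := fun r q => if q == t then slid c zero r1 ch r else F r q.
Let x := c (last r1 ch).

Let dc r : lel (d r) (c r). Proof. exact: (tab_row hF). Qed.
Let trip r s : r < s -> ltl zero (d s) -> lel (d s) (c r) -> ltl (d s) (d r).
Proof. exact: (tab_triple hF). Qed.
Let cinj r s : c r = c s -> ltl zero (c r) -> r = s.
Proof. exact: (tab_inj hF). Qed.

(** Straddling [z] means having a box of the level in column [t] but none in column [t.+1]. This
    turns bottommost rows into last parts equal to [t]. *)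
Lemma straddles_level z M r : level z F M -> straddles c d z r = (M r == t).
Proof.
move=> hM; have := hM r t; have := hM r t.+1; rewrite /straddles -/(d r) -/(c r) => e1 ->.
have -> : lel (d r) z = ~~ ltl z (d r) by rewrite /ltl negbK.
rewrite e1; lia.
Qed.

Lemma bottommost_level z M r : level z F M -> bottommost c d z r -> last_row M t r.
Proof.
move=> hM [h1 h2]; split; first by apply/eqP; rewrite -(straddles_level _ hM).
by move=> s rs /eqP; rewrite -(straddles_level _ hM); apply/negP; apply: h2.
Qed.

Lemma level_slide z M : ltl z x -> level z F M -> exists r,
  [/\ last_row M t r, ltl z (F r t), ~~ ltl z (slid_filling r t) &
    level z slid_filling (shrink_row t r M)].
Proof.
move=> hz hM; have [s [y [[h1 h2 h3 h4 h5] h6]]] := slid_crossing trip hs (lel0 z) hz.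
have hb := bottommost_level hM h1.
have nz : ~~ ltl z (slid c zero r1 ch s) by rewrite h3; letter_order.
exists s; split=> //; first by rewrite /slid_filling eqxx.
move=> r q; rewrite /slid_filling /shrink_row; case: (eqVneq q t) => [->|nq].
  case: (eqVneq r s) => [->|nrs]; first by rewrite (negbTE nz); lia.
  by rewrite h6 // -hM.
case: eqP => [->|//]; rewrite hM; case: hb => -> _; lia.
Qed.

Lemma level_slide_high z M : lel x z -> level z F M -> level z slid_filling M.
Proof.
move=> hz hM r q; rewrite /slid_filling; case: eqP => [->|_]; last exact: hM.
by rewrite (slid_high hs) // -hM.
Qed.

(** A second chain row would lie higher and hold a larger entry, but the first column increases
    downwards. *)
Lemma slide_chain1 : t = 1 -> ch = [::].
Proof.
move=> t1; move: (hs); case: ch => // r' ch' hs'.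
have lt_r'r := slide_dec trip hs' (mem_head _ _).
have [[/andP[_ hb] _] hs2] := slide_cons_inv hs'.
have [/andP[_ hb'] _] := slide_bottommost hs2.
have := tab_col1 hF lt_r'r.
rewrite /c in hb hb' *; rewrite t1 in hb hb'.
move=> h; have := h ltac:(letter_order) hb; letter_order.
Qed.

Lemma tab_slide : tableau_rows (shrink_row t r1 L) slid_filling.
Proof.
have [x0 _] := slide_lt hs.
have lvl : level zero slid_filling (shrink_row t r1 L).
  have [r [h1 _ _ h2]] := level_slide x0 (tab_supp hF).
  have := bottommost_level (tab_supp hF) (slide_bottommost hs).
  by move/(last_row_uniq h1) <-.
have shrink_le q : shrink_row t r1 L q <= L q.
  have [e _] := bottommost_level (tab_supp hF) (slide_bottommost hs).
  by rewrite /shrink_row; case: eqP => [->|//]; rewrite e leq_pred.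
have r10 : r1 != 0.
  have [/andP[_ h] _] := slide_bottommost hs; apply/eqP => e; move: h.
  by rewrite e /c (tab_supp hF) (tab_row0 hF); lia.
split=> //.
- move=> r q; rewrite /slid_filling; case: eqP => _; last exact: (tab_letter hF).
  have [->|[->|[s _ [-> _]]]] := slid_origin trip hs r; try exact: (tab_letter hF).
  by left; rewrite slid_head.
- by rewrite /shrink_row eq_sym (negbTE r10) (tab_row0 hF).
- move=> r q q0; rewrite /slid_filling; case: (eqVneq q.+1 t) => e1.
    have /negbTE -> : q != t by rewrite -e1 ltn_eqF.
    by apply: lel_trans (slid_le hs r) _; rewrite /c -e1; apply: (tab_row hF).
  case: (eqVneq q t) => [->|_]; last exact: (tab_row hF).
  exact: (slid_ge dc hs).
- move=> r s lt_rs; rewrite !lvl /shrink_row => h1 h2; rewrite /slid_filling.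
  case: (eqVneq 1 t) => e1; last first.
    apply: (tab_col1 hF) => //; rewrite (tab_supp hF).
      by have := shrink_le r; rewrite /shrink_row; lia.
    by have := shrink_le s; rewrite /shrink_row; lia.
  rewrite (slide_chain1 (esym e1)) /=.
  have [/negbTE n1 /negbTE n2] : r != r1 /\ s != r1 by split; apply/eqP => e; move: h1 h2; rewrite e eqxx -e1.
  rewrite n1 n2 in h1 h2 *; rewrite /c -e1.
  by apply: (tab_col1 hF) => //; rewrite (tab_supp hF).
(* For the triple condition, the changed column is the right one of the pair, the left one, or
   neither. On the left, entries only decrease, which strengthens the premise. *)
move=> r s q q0 lt_rs; rewrite /slid_filling; case: (eqVneq q.+1 t) => e1.
  have /negbTE -> : q != t by rewrite -e1 ltn_eqF.
  apply: (slid_trip dc trip cinj (b := fun r => F r q)) => // [s'|s1 s2].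
    by rewrite /c -e1; apply: (tab_row hF).
  by rewrite /c -e1; apply: (tab_triple hF).
case: (eqVneq q t) => [->|_]; last exact: (tab_triple hF).
move=> h1 h2; apply: (tab_triple hF) => //.
exact: lel_trans h2 (slid_le hs r).
Qed.

End ColumnSlide.

(** [nextr] searches only above the current row, which suffices by [bottommost_up]; as the rows
    decrease, the row index is enough fuel. *)
Lemma chain_slide L F t : 0 < t -> tableau_rows L F -> forall n r y, r <= n ->
  bottommost (F^~ t) (F^~ t.+1) y r ->
  slide (F^~ t) (F^~ t.+1) y r (chain F t n r).
Proof.
move=> t0 hF.
have F0 q : F 0 q = zero.
  have := tab_supp hF 0 q; rewrite (tab_row0 hF).
  by case: (tab_letter hF 0 q) => // h; case: (F 0 q) h => [[] []] //=; case: q.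
have trip r s : r < s -> ltl zero (F s t.+1) -> lel (F s t.+1) (F r t) -> ltl (F s t.+1) (F r t.+1).
  exact: (tab_triple hF).
elim=> [|n IH] r y hr hb.
  have r0 : r = 0 by lia.
  by case: hb => /andP[_]; rewrite r0 F0; letter_order.
set P : pred nat := fun s => ltl (F r t) (F s t) && lel (F s t.+1) (F r t).
rewrite /=; have [hh|hh] := boolP (has P (iota 1 r.-1)).
  have [h1 h2 h3] := last_filter_iota hh.
  have -> : nextr F t r = Some (last 0 (filter P (iota 1 r.-1))).
    by rewrite /nextr -/P; move: hh; rewrite has_filter; case: (filter P _).
  move: (last 0 _) h1 h2 h3 => r' h1 h2 h3.
  apply: slide_step => //; apply: IH; first by lia.
  split; first by rewrite /straddles andbC.
  move=> s hs; have [hrs|hsr] := leqP r s; first exact: (bottommost_up trip hb).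
  by rewrite /straddles andbC -/(P s); apply: h3; rewrite hs; lia.
have -> : nextr F t r = None.
  by rewrite /nextr -/P; move: hh; rewrite has_filter; case: (filter P _).
apply: slide_end => // s; have [hrs|hsr] := leqP r s; first exact: (bottommost_up trip hb).
apply/negP => h; case/hasP: hh; exists s; last by rewrite /P andbC.
rewrite mem_iota; case: s h hsr => [|s] h hsr; last by lia.
by move: h; rewrite /straddles /= !F0 => /andP[_]; letter_order.
Qed.

Lemma tab_zero L F r c : tableau_rows L F -> ~~ ltl zero (F r c) -> F r c = zero.
Proof.
by move=> hF; case: (tab_letter hF r c) => // h; case: (F r c) h => [[] []].
Qed.

Definition pivot (t : nat) (a : seq nat) : nat := last 0 [seq r <- iota 1 (size a) | part a r == t].

Section Phi.
Variables (t : nat) (a : seq nat) (f : filling).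
Hypotheses (t0 : 0 < t) (ta : t \in a).
Let F := ext a f.
Hypothesis hF : tableau_rows (rowlen a) F.
Let r1 := pivot t a.
Let ch := chain F t r1 r1.
Let x := F (last r1 ch) t.
Let a' := remove_box t r1 a.
Let G := slid_filling F t r1 ch.

Lemma pivot_last : last_row (rowlen a) t r1. Proof. exact: last_row_part. Qed.

Lemma pivot_slide : slide (F^~ t) (F^~ t.+1) zero r1 ch.
Proof.
apply: (chain_slide t0 hF) => //; have [h1 h2] := pivot_last; split.
  by rewrite (straddles_level t0 _ (tab_supp hF)) h1.
by move=> s hs; rewrite (straddles_level t0 _ (tab_supp hF)); apply/eqP/h2.
Qed.

Lemma tab_phi_slid : tableau_rows (shrink_row t r1 (rowlen a)) G.
Proof. exact: tab_slide pivot_slide. Qed.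

(** The comparison goes through [ext], since the filling returned by [phi] may keep a stale entry in
    the deleted box, where the slid column has [zero]. *)
Lemma phiE : exists f', phi t (a, f) = ((a', f'), x) /\
  forall r c, ext a' f' r c = G (skip_row t r1 r) c.
Proof.
have [h1 _] := pivot_last; have hs := pivot_slide.
eexists; split; first by rewrite /phi /= -/F -/(pivot t a) -/r1 -/ch; reflexivity.
move=> r c; rewrite /ext in_shapeE rowlen_remove // -/(skip_row t r1 r).
rewrite -(tab_supp tab_phi_slid); set u := skip_row t r1 r.
case: ifP => [pos|/negbT npos]; last by rewrite (tab_zero tab_phi_slid).
move: pos; rewrite /G /slid_filling.
have trip p s : p < s -> ltl zero (F s t.+1) -> lel (F s t.+1) (F p t) -> ltl (F s t.+1) (F p t.+1).
  exact: (tab_triple hF).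
case: (eqVneq c t) => [->|_] //=; case: ifP => [uch|nuch] pos.
  by rewrite (slid_in trip hs uch).
have nur : u != r1 by apply/eqP => e; move: pos; rewrite e slid_head.
by rewrite slid_notin // inE negb_or nur nuch.
Qed.

End Phi.

(* Separates the unbarred from the barred letters; not itself a letter. *)
Definition bar0 : letter := (true, 0).

Lemma barred_level x : x = zero \/ is_letter x -> barred x = ltl bar0 x.
Proof. by case=> [->//|]; case: x => [[] n]; rewrite /is_letter /ltl /lel /= ?leqn0 ?lt0n. Qed.

Lemma barred_lel x y : barred x -> lel x y -> barred y.
Proof. by case: x y => [[] m] [[] n]. Qed.

(** Truncated subtraction sends the rows above the inner shape to row [0], of length [0]. *)
Definition inner_len (a b : seq nat) (r : nat) : nat := rowlen b (r - (size a - size b)).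

(** These counts determine column [q] of the sorted tableau, and so let the jeu de taquin be
    compared with [phi]. *)
Definition above (a : seq nat) (F : filling) (q : nat) (z : letter) : nat :=
  count (fun r => ltl z (F r q)) (iota 1 (size a)).

Lemma tab_reindex L F L' F' (g : nat -> nat) : tableau_rows L F -> g 0 = 0 ->
  (forall r s, r < s -> g r < g s) -> (forall r, L' r = L (g r)) ->
  (forall r c, F' r c = F (g r) c) -> tableau_rows L' F'.
Proof.
move=> hF g0 gm eL eF; split; rewrite ?eL ?g0 //.
- by move=> r c; rewrite eF; apply: (tab_letter hF).
- by move=> r c; rewrite eF eL; apply: (tab_supp hF).
- exact: (tab_row0 hF).
- by move=> r c; rewrite !eF; apply: (tab_row hF).
- by move=> r s /gm; rewrite !eF; apply: (tab_col1 hF).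
- by move=> r s c c0 /gm; rewrite !eF; apply: (tab_triple hF).
Qed.

Lemma count_differ (s : seq nat) (P P' : pred nat) x : uniq s -> x \in s -> P x -> ~~ P' x ->
  (forall y, y != x -> P' y = P y) -> count P s = (count P' s).+1.
Proof.
move=> us xs Px P'x h; rewrite !(permP (perm_to_rem xs)) /= Px (negbTE P'x) add1n add0n.
congr S; apply: eq_in_count => y; rewrite rem_filter // mem_filter => /andP[/= ny _].
by rewrite h.
Qed.

Lemma above_le L a F q z : tableau_rows L F -> 0 < q -> above a F q.+1 z <= above a F q z.
Proof.
move=> hF q0; apply: sub_count => r /=; have := tab_row hF r q0; letter_order.
Qed.

Lemma skip_row_mono t r1 r s : r < s -> skip_row t r1 r < skip_row t r1 s.
Proof. by rewrite /skip_row => h; do 2!(case: ifP => ?); lia. Qed.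

Lemma skip_row_id t r1 r : 1 < t -> skip_row t r1 r = r.
Proof. by rewrite /skip_row => h; case: ifP => //; lia. Qed.

(** * The effect of one operator on shapes, levels and column counts *)

Section PhiStep.
Variables (t : nat) (a : seq nat) (F : filling).
Hypotheses (t0 : 0 < t) (hF : tableau_rows (rowlen a) F).
Variables (r1 : nat) (ch : seq nat).
Hypotheses (hr1 : last_row (rowlen a) t r1) (hs : slide (F^~ t) (F^~ t.+1) zero r1 ch).
Let x := F (last r1 ch) t.
Let a' := remove_box t r1 a.
Let G := slid_filling F t r1 ch.
Variable F' : filling.
Hypothesis hF' : forall r c, F' r c = G (skip_row t r1 r) c.

Let trip p s : p < s -> ltl zero (F s t.+1) -> lel (F s t.+1) (F p t) -> ltl (F s t.+1) (F p t.+1).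
Proof. exact: (tab_triple hF). Qed.

Let r1_bounds : 0 < r1 <= size a.
Proof. by case: hr1 => h _; apply: rowlen_size; rewrite h. Qed.

Lemma skip_row0 : skip_row t r1 0 = 0.
Proof. by rewrite /skip_row; case: ifP => //; move: r1_bounds; lia. Qed.

Lemma step_tab : tableau_rows (rowlen a') F'.
Proof.
apply: (tab_reindex (tab_slide t0 hF hs) skip_row0 (@skip_row_mono t r1)) => // r.
by rewrite rowlen_remove //; case: hr1.
Qed.

Lemma step_composition : composition a -> composition a'.
Proof. exact: (composition_remove t0 (proj1 hr1)). Qed.

Lemma step_mem : 1 < t -> t.-1 \in a'.
Proof.
move=> t1; case: hr1 => h _; apply: (@last_row_mem _ _ r1); first by lia.
by rewrite rowlen_remove // skip_row_id // /shrink_row eqxx.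
Qed.

Lemma exit_pos : ltl zero x.
Proof. by case: (slide_lt hs). Qed.

Lemma exit_letter : is_letter x.
Proof. by case: (tab_letter hF (last r1 ch) t) => // e; move: exit_pos; rewrite /x e. Qed.

(** This becomes the triple condition for the last row of [gamma], whose box in column [t.+1]
    receives [x]. *)
Lemma step_separates r : lel x (F' r t) -> ltl x (F' r t.+1).
Proof.
rewrite !hF' /G /slid_filling eqxx (gtn_eqF (ltnSn t)).
apply: (slid_no_straddle _ hs) => p s; exact: (tab_inj hF).
Qed.

Lemma step_right r c : t < c -> F' r c = F (skip_row t r1 r) c.
Proof. by move=> h; rewrite hF' /G /slid_filling gtn_eqF. Qed.

(** The row that crosses [z] now has an entry at most [z] in column [t], while its entry in column
    [t.-1] still exceeds [z]. As it straddles [z] for the next operator, the next exiting entry is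
    at least [x]. *)
Lemma step_gap z : 1 < t -> ltl z x -> exists s, ltl z (F' s t.-1) && lel (F' s t) z.
Proof.
move=> t1 hz; have [s [y [[h1 h2 h3 h4 h5] _]]] := slid_crossing trip hs (lel0 z) hz.
exists s; rewrite !hF' skip_row_id // /G /slid_filling eqxx h3 h4 andbT.
have /negbTE -> : t.-1 != t by lia.
by have := tab_row hF s (c := t.-1) ltac:(lia); rewrite prednK //; letter_order.
Qed.

Lemma step_unbarred b : composition b -> size b <= size a -> ~~ barred x ->
  level bar0 F (inner_len a b) -> size b <= size a' /\ level bar0 F' (inner_len a' b).
Proof.
move=> cb hba nx hM.
have hx : lel x bar0.
  by move: nx; rewrite barred_level; [rewrite /ltl negbK|right; exact: exit_letter].
have hM' := level_slide_high hs hx hM.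
have sza : size a' = size a - (t == 1) by apply: size_remove => //; case: hr1.
have [t1|nt1] := eqVneq t 1; last first.
  split; first by rewrite sza; lia.
  move=> r c; rewrite hF' skip_row_id; last by lia.
  by rewrite /G hM' /inner_len sza (negbTE nt1) subn0.
(* When a whole row disappears, its emptied box is not barred, so the row lies above the inner shape
   and only the offset changes. *)
have b0 : inner_len a b r1 = 0.
  have := hM' r1 t; rewrite {1}/slid_filling eqxx slid_head (_ : ltl bar0 zero = false) // t1; lia.
have r1off : r1 <= size a - size b.
  rewrite leqNgt; apply/negP => h; have := rowlen_gt0 cb (r := r1 - (size a - size b)).
  by rewrite -/(inner_len a b r1) b0; move: r1_bounds; lia.
split; first by rewrite sza t1; move: r1_bounds; lia.
move=> r c; rewrite hF' /G hM'; congr (_ && (_ <= _)).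
rewrite /inner_len sza t1 /skip_row /=; case: leqP => h.
  by congr rowlen; move: r1_bounds; lia.
have -> : r - (size a - size b) = 0 by lia.
by have -> : r - (size a - 1 - size b) = 0 by lia.
Qed.

Lemma step_barred b : composition b -> size b <= size a -> barred x ->
  level bar0 F (inner_len a b) -> exists b', [/\ dop t b = Some b', composition b',
    size b' <= size a' & level bar0 F' (inner_len a' b')].
Proof.
move=> cb hba nx hM.
have hx : ltl bar0 x by rewrite -barred_level //; right; exact: exit_letter.
have [r [[h1 h2] h3 h4 h5]] := level_slide t0 hF hs hx hM.
set off := size a - size b.
have hrb : last_row (rowlen b) t (r - off).
  split; first exact: h1.
  move=> s lt_s; have := h2 (s + off); rewrite /inner_len addnK; apply.
  by move: lt_s; clearbody off; clear; lia.
have /rowlen_size rb : 0 < rowlen b (r - off) by case: hrb => ->.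
have sza : size a' = size a - (t == 1) by apply: size_remove => //; case: hr1.
have szb : size (remove_box t (r - off) b) = size b - (t == 1) by apply: size_remove => //; case: hrb.
have sz : size (remove_box t (r - off) b) <= size a' by rewrite sza szb; lia.
exists (remove_box t (r - off) b); split=> //.
- exact: dopE.
- exact: (composition_remove t0 (proj1 hrb)).
have eoff : size a' - size (remove_box t (r - off) b) = off by rewrite sza szb /off; lia.
move=> p c; rewrite hF' /G h5; congr (_ && (_ <= _)).
rewrite {2}/inner_len eoff (rowlen_remove _ t0 (proj1 hrb)).
have [t1|nt1] := eqVneq t 1; last first.
  rewrite skip_row_id; last by lia.
  rewrite /skip_row; case: ifP => [|_]; first by lia.
  rewrite /shrink_row (_ : (p - off == r - off) = (p == r)) //; lia.
(* For [t = 1] the chain has a single row, so the inner and the outer shape lose the same row. *)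
have er : r = r1.
  apply/eqP/negPn/negP => /negbTE ne; move: h4.
  by rewrite /slid_filling eqxx (slide_chain1 t0 hF hs t1) /= ne h3.
have tm : (t.-1 == 0) = true by rewrite t1.
rewrite er in rb *; rewrite /skip_row tm /=.
rewrite (_ : (r1 - off <= p - off) = (r1 <= p)); last by lia.
case: ifP => h; rewrite /shrink_row.
  have /negbTE -> : p.+1 != r1 by lia.
  have /negbTE -> : (p - off).+1 != r1 - off by lia.
  by rewrite /inner_len -/off; congr rowlen; lia.
have /negbTE -> : p != r1 by lia.
by have /negbTE -> : p - off != r1 - off by lia.
Qed.

(** No row straddles [x]. Together with [above_lt], this singles out [x] as the least letter at
    which the counts in the two columns agree. *)
Lemma above_exit : above a F t.+1 x = above a F t x.
Proof.
apply: eq_count => r /=; have := slide_exit hs r; rewrite /straddles -/x.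
have := tab_row hF r t0 => h1 h2; apply/idP/idP; letter_order.
Qed.

Lemma above_lt z : ltl z x -> above a F t.+1 z < above a F t z.
Proof.
move=> hz; have [s [y [[[h1 _] h2 h3 h4 h5] _]]] := slid_crossing trip hs (lel0 z) hz.
have sa : s \in iota 1 (size a).
  have : ltl zero (F s t) by letter_order.
  rewrite (tab_supp hF) mem_iota => /andP[h6 h7].
  by have := @rowlen_size a s; lia.
rewrite /above !(permP (perm_to_rem sa)) /= h5.
case/andP: h1 => h1 _.
have -> : ltl z (F s t.+1) = false by apply/negP; letter_order.
rewrite ltnS; apply: sub_count => r /=; have := tab_row hF r t0; letter_order.
Qed.

(** Over all [z], this says that column [t] loses [x] as a multiset. *)
Lemma above_step z : 1 < t -> above a' F' t z + ltl z x = above a F t z.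
Proof.
move=> t1; have sza : size a' = size a.
  by rewrite size_remove //; [lia|case: hr1].
have eF' r : F' r t = slid (F^~ t) zero r1 ch r.
  by rewrite hF' skip_row_id // /G /slid_filling eqxx.
have [hz|hz] := boolP (ltl z x).
  have [s [y [[[h1 _] h2 h3 h4 h5] h6]]] := slid_crossing trip hs (lel0 z) hz.
  have sa : s \in iota 1 (size a).
    have : ltl zero (F s t) by letter_order.
    rewrite (tab_supp hF) mem_iota => /andP[h7 h8].
    by have := @rowlen_size a s; lia.
  rewrite addn1 /above sza; symmetry; apply: (count_differ (x := s)) => //.
  - exact: iota_uniq.
  - by rewrite eF' h3; letter_order.
  - by move=> r nr; rewrite eF'; apply: h6.
rewrite addn0 /above sza; apply: eq_count => r /=; rewrite eF'.
by apply: (slid_high hs); move: hz; rewrite /ltl negbK.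
Qed.

Lemma above_left q z : 1 < t -> q != t -> above a' F' q z = above a F q z.
Proof.
move=> t1 nq; rewrite /above size_remove //; last by case: hr1.
have /negbTE -> : t != 1 by lia.
by rewrite subn0; apply: eq_count => r /=; rewrite hF' skip_row_id // /G /slid_filling (negbTE nq).
Qed.

End PhiStep.

(** * Jeu de taquin *)

(** Past the end the default [zero] exceeds no letter, so [k] needs no upper bound. *)
Lemma nth_sorted_above z s k : sorted (fun x y => lel y x) s -> 0 < k ->
  ltl z (nth zero s k.-1) = (k <= count (ltl z) s).
Proof.
elim: s k => [|y s IH] k /=; first by move=> _ k0; rewrite nth_nil leqNgt k0; apply/negbTE; letter_order.
move=> hp k0; have hs := path_sorted hp.
have [hz|hz] := boolP (ltl z y); first by case: k k0 => [//|[|k]] _ //=; rewrite add1n ltnS -(IH k.+1).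
have tr : transitive (fun x y => lel y x) by move=> u v w h1 h2; apply: lel_trans h2 h1.
have /allP hall := order_path_min tr hp.
have -> : count (ltl z) s = 0.
  apply/eqP; rewrite -leqn0 leqNgt -has_count; apply/hasPn => u /hall /=; letter_order.
rewrite addn0 leqNgt k0 /=; apply/negbTE.
case: k k0 => [//|[|k]] _ //=.
have [h|h] := ltnP k (size s); last by rewrite nth_default //; letter_order.
by have hl : lel (nth zero s k) y := hall _ (mem_nth zero h); letter_order.
Qed.

Lemma rho_above a f z k q : 0 < q -> 0 < k ->
  ltl z (rho a f k q) = (k <= above a (ext a f) q z).
Proof.
move=> q0 k0; rewrite /rho nth_sorted_above //; last first.
  by apply: sort_sorted => u v; apply: lel_total.
rewrite count_sort /colseq count_map count_filter /above; congr (_ <= _).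
apply: eq_in_count => r; rewrite mem_iota /= /ext /in_shape q0 => hr.
case: ifP => h.
  have -> : q <= part a r by lia.
  by rewrite andbT.
have -> : (q <= part a r) = false by lia.
by rewrite andbF; symmetry; apply/negbTE; letter_order.
Qed.

Lemma jdt_hmoves_col1 T n p : jdt_hmoves T n p 1 = [::].
Proof.
elim: n p => //= n IH p; case: ifP => // h.
by have -> : (p == 1) = false by move: h; rewrite andbT.
Qed.

(** Follows the empty box down column [t.+1] until it moves left in row [p']. The last two clauses
    record the comparison that stopped the descent and those that allowed it. The fuel suffices
    because each move lowers the coordinate sum by one. *)
Lemma jdt_hmoves_next T n p t : 0 < t -> 0 < p -> p + t <= n -> exists p' n',
  [/\ jdt_hmoves T n p t.+1 = (t, T p' t) :: jdt_hmoves T n' p' t,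
    0 < p' <= p, p' + t.-1 <= n', p' = 1 \/ ltl (T p' t) (T p'.-1 t.+1)
  & forall k, p' < k <= p -> lel (T k.-1 t.+1) (T k t)].
Proof.
move=> t0; elim: n p => [|n IH] p p0 hn; first by lia.
rewrite /= eqSS (gtn_eqF t0) andbF.
have [->|p1] := eqVneq p 1.
  by exists 1, n; split=> //; [lia|left|move=> k; lia].
case: ifP => h; last first.
  exists p, n; split=> //; [lia|lia| |move=> k; lia].
  by right; rewrite /ltl h.
have [p' [n' [h1 h2 h3 h4 h5]]] := IH p.-1 ltac:(lia) ltac:(lia).
exists p', n'; split=> //; first lia.
move=> k hk; have [->//|nk] := eqVneq k p; apply: h5; lia.
Qed.

(* [p] is the row of the empty box in column [t+1], [F] the current tableau on the composition
   side, and [T] the original partition-shaped tableau, whose column [t+1] still contains the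
   entry [T p t.+1] that has already left [F]. *)
Definition jdt_inv (T : filling) (a : seq nat) (F : filling) (t p : nat) : Prop :=
  [/\ 0 < p,
    forall z q k, 0 < q <= t -> 0 < k -> ltl z (T k q) = (k <= above a F q z),
    forall z k, 0 < k -> ltl z (T k t.+1) = (k <= above a F t.+1 z + ltl z (T p t.+1))
  & forall z, above a F t.+1 z + ltl z (T p t.+1) <= above a F t z].

(** At the moved entry [X], column [t.+1] has at least [p'.-1] larger entries and column [t] at most
    that many, so [X] is not below [x]. If it were above [x], the box would have descended too
    far. *)
Lemma jdt_exit T a F t p x n : 0 < t -> p + t <= n -> jdt_inv T a F t p ->
  above a F t.+1 x = above a F t x ->
  (forall z, ltl z x -> above a F t.+1 z < above a F t z) ->
  exists p' n', [/\ jdt_hmoves T n p t.+1 = (t, x) :: jdt_hmoves T n' p' t,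
    0 < p', T p' t = x & p' + t.-1 <= n'].
Proof.
move=> t0 hn [p0 J1 J2 J3] hx hlt.
have [p' [n' [e /andP[p'0 hp'] hn' hstop hgo]]] := jdt_hmoves_next T t0 p0 hn.
suff ex : T p' t = x by exists p', n'; rewrite -ex.
set X := T p' t in e hstop *.
have C1 : above a F t X < p'.
  have := J1 X t p' ltac:(lia) p'0; rewrite -/X /ltl lel_refl; lia.
have D1 : p'.-1 <= above a F t.+1 X.
  have [p'1|p'1] := eqVneq p' 1; first by rewrite p'1.
  case: hstop => [/eqP h|h]; first by rewrite h in p'1.
  have := J2 X p'.-1 ltac:(lia); have := J2 X p ltac:(lia); rewrite h.
  by case: (ltl X (T p t.+1)); lia.
have nlt : ~~ ltl X x by apply/negP => /hlt; lia.
apply: lel_anti; last by move: nlt; rewrite /ltl negbK.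
apply/negPn/negP => ltxX; change (is_true (ltl x X)) in ltxX.
(* [k] is the first row of column [t] with an entry at most [x]. If the box descended from row [k],
   column [t.+1] has too few entries above [x]; if it started lower, [T p t.+1] is one entry above
   [x] too many. *)
set k := (above a F t x).+1.
have hk : p' < k by have := J1 x t p' ltac:(lia) p'0; rewrite -/X ltxX /k; lia.
have Tk : lel (T k t) x.
  by have := J1 x t k ltac:(lia) ltac:(lia); rewrite /ltl /k; lia.
have := J3 x; rewrite hx => J3x.
have [kp|pk] := leqP k p.
  have := hgo k ltac:(lia) => h.
  have := J2 x k.-1 ltac:(lia); rewrite hx.
  have -> : ltl x (T k.-1 t.+1) = false by apply/negbTE; letter_order.
  rewrite /k; lia.
have := J2 x p p0; rewrite hx /k in pk *; lia.
Qed.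

Lemma jdt_inv_step T a F t p r1 ch F' p' : tableau_rows (rowlen a) F ->
  last_row (rowlen a) t.+1 r1 -> slide (F^~ t.+1) (F^~ t.+2) zero r1 ch ->
  (forall r c, F' r c = slid_filling F t.+1 r1 ch (skip_row t.+1 r1 r) c) ->
  jdt_inv T a F t.+1 p -> 0 < t -> 0 < p' -> T p' t.+1 = F (last r1 ch) t.+1 ->
  jdt_inv T (remove_box t.+1 r1 a) F' t p'.
Proof.
move=> hF hr1 hs hF' [_ J1 _ _] t0 p'0 eT; have t1 : 0 < t.+1 by [].
split=> //.
- move=> z q k hq k0; rewrite (above_left t1 hr1 hF') ?J1 //; lia.
- by move=> z k k0; rewrite eT (above_step t1 hF hr1 hs hF') // J1 //; lia.
- move=> z; rewrite eT (above_step t1 hF hr1 hs hF') // (above_left t1 hr1 hF') //; last by lia.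
  exact: (above_le a z hF t0).
Qed.

Lemma phisS t st : phis t.+1 st =
  let (st1, x) := phi t.+1 st in let (st2, H) := phis t st1 in (st2, x :: H).
Proof. by []. Qed.

Lemma vdownS t a : vdown t.+1 a = obind (vdown t) (dop t.+1 a).
Proof. by []. Qed.

(** [T p t.+1] is the letter that left at the previous step, [zero] at the outset; as every smaller
    level is straddled, the exits increase. The clause on columns beyond [t] says that their rows
    are only reindexed, which preserves the separation already obtained there. *)
Lemma phis_spec t : forall a f b T p n,
  composition a -> tableau_rows (rowlen a) (ext a f) -> (0 < t -> t \in a) ->
  composition b -> size b <= size a -> level bar0 (ext a f) (inner_len a b) ->
  (0 < t -> [/\ p + t <= n, jdt_inv T a (ext a f) t p &
    forall z, ltl z (T p t.+1) -> exists s, ltl z (ext a f s t) && lel (ext a f s t.+1) z]) ->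
  exists a1 f1 H b1,
  [/\ phis t (a, f) = ((a1, f1), H), vdown t a = Some a1, composition a1 &
      tableau_rows (rowlen a1) (ext a1 f1)] /\
  [/\ vdown (count barred H) b = Some b1, composition b1, size b1 <= size a1 &
      level bar0 (ext a1 f1) (inner_len a1 b1)] /\
  [/\ size H = t, all is_letter H, path lel (T p t.+1) H &
      jbar (jdt_hmoves T n p t.+1) = count barred H] /\
  (forall r, exists r', forall c, t < c -> ext a1 f1 r c = ext a f r' c) /\
  (forall q r, 0 < q <= t -> lel (nth zero H (t - q)) (ext a1 f1 r q) ->
      ltl (nth zero H (t - q)) (ext a1 f1 r q.+1)).
Proof.
elim: t => [|t IH] a f b T p n ca hF ta cb hba hM hT.
  exists a, f, [::], b; split; [by split|split; [by split|split; [|split]]].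
  - by rewrite jdt_hmoves_col1.
  - by move=> r; exists r.
  - by move=> q r; lia.
have [hn hJ hgap] := hT isT; have t0 : 0 < t.+1 by [].
have hr1 := pivot_last t0 (ta isT).
have hs := pivot_slide t0 (ta isT) hF.
have [f' [ephi hF']] := phiE t0 (ta isT) hF.
set r1 := pivot t.+1 a in hr1 hs ephi hF'.
set ch := chain _ _ _ _ in hs ephi hF'.
set F := ext a f in hF hM hgap hs ephi hF' hJ *.
set a' := remove_box _ _ _ in ephi hF'.
set F' := ext a' f' in hF'.
set x := F (last r1 ch) t.+1 in ephi.
have [p' [n' [emov p'0 eT hn']]] := jdt_exit t0 hn hJ (above_exit t0 hF hs)
  (above_lt t0 hF hr1 hs).
have hexp : lel (T p t.+2) x.
  apply/negPn/negP => h; have [s] := hgap x h.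
  by have := slide_exit hs s; rewrite /straddles andbC => /negP.
have [b' [hb' cb' szb' hM']] : exists b', [/\ 
    (if barred x then dop t.+1 b = Some b' else b' = b), composition b',
    size b' <= size a' & level bar0 F' (inner_len a' b')].
  have [bx|bx] := boolP (barred x).
    have [b' [h1 h2 h3 h4]] := step_barred t0 hF hr1 hs hF' cb hba bx hM.
    by exists b'.
  by have [h1 h2] := step_unbarred t0 hF hr1 hs hF' cb hba bx hM; exists b.
have [||||a1 [f1 [H [b1 [[e1 e2 e3 e4] [[e5 e6 e7 e8] [[e9 e10 e11 e12] [e13 e14]]]]]]]] :=
  IH a' f' b' T p' n' _ _ _ cb' szb' hM'.
- exact: (step_composition t0 hr1 ca).
- exact: (step_tab t0 hF hr1 hs hF').
- by move=> t1; exact: (step_mem t0 hr1 t1).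
- move=> t1; split; first by rewrite -[t]/(t.+1.-1).
    exact: (jdt_inv_step hF hr1 hs hF' hJ t1 p'0 eT).
  by move=> z; rewrite eT => hz; apply: (step_gap t0 hF hr1 hs hF' (t1 : 1 < t.+1) hz).
rewrite eT in e11.
exists a1, f1, (x :: H), b1; split; [split=> //|split; [split=> //|split; [split=> //|split]]].
- by rewrite phisS ephi e1.
- by rewrite vdownS (dopE t0 hr1).
(* If [x] is barred, so are all later exits, being at least as large; the operators applied to [b]
   are then those of indices [t.+1] down to [1]. *)
- move: hb'; rewrite /=; case: ifP => bx hb'; last by rewrite hb' in e5.
  have hall : all barred H.
    apply/allP => u uH; have /allP/(_ u uH) := order_path_min lel_trans e11.
    exact: (barred_lel bx).
  have ec : count barred H = t by rewrite -e9; apply/eqP; rewrite -all_count.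
  by rewrite add1n ec vdownS hb' /= -ec.
- by rewrite /= e9.
- by rewrite /= e10 (exit_letter hF hs).
- by rewrite /= hexp.
(* For the same reason, if [x] is barred then both the greatest barred source column and the count
   are [t.+1]. *)
- rewrite emov /jbar /= ; case: ifP => bx /=; rewrite -/(jbar _) e12 //.
  have hall : all barred H.
    apply/allP => u uH; have /allP/(_ u uH) := order_path_min lel_trans e11.
    exact: (barred_lel bx).
  by move: hall; rewrite all_count e9 => /eqP ->; rewrite add1n; apply/maxn_idPl.
- move=> r; have [r' hr'] := e13 r; exists (skip_row t.+1 r1 r') => c hc.
  by rewrite hr'; [exact: (step_right hF')|exact: ltnW].
- move=> q r hq; have [eq|nq] := eqVneq q t.+1; last first.
    have qt : q <= t by move: hq nq; clear; lia.
    by rewrite subSn //=; apply: e14; case/andP: hq => ->.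
  rewrite eq subnn /=; have [r' hr'] := e13 r; rewrite !hr' ?leqnSn //.
  exact: (step_separates t0 hF hs hF').
Qed.

(** * Independence of the barred entries *)

(** Identifies all barred letters, so that equal images mean the same unbarred entries in the same
    places. *)
Definition unbar (x : letter) : option letter := if barred x then None else Some x.

Lemma unbar_barred x y : unbar x = unbar y -> barred x = barred y.
Proof. by rewrite /unbar; case: ifP; case: ifP. Qed.

Lemma unbar_eq x y : unbar x = unbar y -> ~~ barred x -> x = y.
Proof. by rewrite /unbar; case: ifP => //; case: ifP => // _ _ [->]. Qed.

(** Entries increase along the chain, so after a barred one only barred letters replace barred
    letters, and a barred letter exits. Row [r] is excepted because [y] need not be barred. *)
Lemma slide_barred c d y r ch : slide c d y r ch -> barred (c r) ->
  (forall s, s != r -> unbar (slid c y r ch s) = unbar (c s)) /\ unbar (c (last r ch)) = None.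
Proof.
elim=> {y r ch} [y r hb _|y r r' ch hb hs IH] br /=.
  by split; [move=> s /negbTE ->|rewrite /unbar br].
have br' : barred (c r').
  apply: barred_lel br _; have [/andP[_ h] _] := slide_bottommost hs; letter_order.
have [h1 h2] := IH br'; split=> // s /negbTE ->.
have [->|/h1//] := eqVneq s r'.
by rewrite slid_head /unbar br br'.
Qed.

(** How a barred letter compares with an unbarred one does not depend on which barred letter it
    is. *)
Lemma nextr_unbar F1 F2 t r : (forall s c, unbar (F1 s c) = unbar (F2 s c)) ->
  ~~ barred (F1 r t) -> nextr F1 t r = nextr F2 t r.
Proof.
move=> hu nb; rewrite /nextr -(unbar_eq (hu r t) nb).
rewrite (_ : filter _ _ = [seq s <- iota 1 r.-1 | ltl (F1 r t) (F2 s t) && lel (F2 s t.+1) (F1 r t)]) //.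
apply: eq_filter => s; congr (_ && _).
  have := hu s t; have := unbar_eq (hu s t); have := unbar_barred (hu s t).
  case: (boolP (barred (F1 s t))) => [b1 b2 _ _|_ _ /(_ isT) -> //].
  by move: nb b1 b2; rewrite /ltl; case: (F1 r t) (F1 s t) (F2 s t) => [[] ?] [[] ?] [[] ?].
have := hu s t.+1; have := unbar_eq (hu s t.+1); have := unbar_barred (hu s t.+1).
case: (boolP (barred (F1 s t.+1))) => [b1 b2 _ _|_ _ /(_ isT) -> //].
by move: nb b1 b2; case: (F1 r t) (F1 s t.+1) (F2 s t.+1) => [[] ?] [[] ?] [[] ?].
Qed.

(** The two chains coincide up to the first barred entry; beyond it they may differ, but by
    [slide_barred] only in ways that [unbar] does not see. *)
Lemma chain_unbar F1 F2 t : (forall s c, unbar (F1 s c) = unbar (F2 s c)) ->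
  forall n r y1 y2, let ch1 := chain F1 t n r in let ch2 := chain F2 t n r in
  slide (F1^~ t) (F1^~ t.+1) y1 r ch1 -> slide (F2^~ t) (F2^~ t.+1) y2 r ch2 ->
  unbar y1 = unbar y2 ->
  (forall s, unbar (slid (F1^~ t) y1 r ch1 s) = unbar (slid (F2^~ t) y2 r ch2 s)) /\
  unbar (F1 (last r ch1) t) = unbar (F2 (last r ch2) t).
Proof.
move=> hu; elim=> [|n IH] r y1 y2 ch1 ch2 hs1 hs2 ey.
  by split=> //= s; case: ifP.
have [b1|nb1] := boolP (barred (F1 r t)).
  have b2 : barred (F2 r t) by rewrite -(unbar_barred (hu r t)).
  have [h1 h2] := slide_barred hs1 b1; have [h3 h4] := slide_barred hs2 b2.
  split; last by rewrite h2 h4.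
  move=> s; have [->|ns] := eqVneq s r; first by rewrite !slid_head.
  by rewrite h1 ?h3.
move: hs1 hs2; rewrite /ch1 /ch2 /= -(nextr_unbar hu nb1).
case: (nextr F1 t r) => [r'|] hs1 hs2; last by split=> //= s; case: ifP.
have [_ hs1'] := slide_cons_inv hs1; have [_ hs2'] := slide_cons_inv hs2.
have [h1 h2] := IH r' _ _ hs1' hs2' (hu r t).
by split=> //= s; case: ifP.
Qed.

Lemma phis_unbar t : forall a f1 f2,
  composition a -> tableau_rows (rowlen a) (ext a f1) -> tableau_rows (rowlen a) (ext a f2) ->
  (0 < t -> t \in a) -> (forall r c, unbar (ext a f1 r c) = unbar (ext a f2 r c)) ->
  exists a' g1 g2 H1 H2, [/\ phis t (a, f1) = ((a', g1), H1), phis t (a, f2) = ((a', g2), H2),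
    forall r c, unbar (ext a' g1 r c) = unbar (ext a' g2 r c) & map unbar H1 = map unbar H2].
Proof.
elim: t => [|t IH] a f1 f2 ca hF1 hF2 ta hu; first by exists a, f1, f2, [::], [::].
have t0 : 0 < t.+1 by []; have hr1 := pivot_last t0 (ta isT).
have hs1 := pivot_slide t0 (ta isT) hF1; have hs2 := pivot_slide t0 (ta isT) hF2.
have [g1 [e1 h1]] := phiE t0 (ta isT) hF1; have [g2 [e2 h2]] := phiE t0 (ta isT) hF2.
have [hslid hx] := chain_unbar hu hs1 hs2 erefl.
have [||||a' [k1 [k2 [H1 [H2 [d1 d2 d3 d4]]]]]] := IH _ g1 g2 (step_composition t0 hr1 ca).
- exact: (step_tab t0 hF1 hr1 hs1 h1).
- exact: (step_tab t0 hF2 hr1 hs2 h2).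
- by move=> t1; exact: (step_mem t0 hr1 t1).
- by move=> r c; rewrite h1 h2 /slid_filling; case: ifP.
exists a', k1, k2, (ext a f1 (last (pivot t.+1 a) (chain (ext a f1) t.+1 (pivot t.+1 a) (pivot t.+1 a))) t.+1 :: H1),
  (ext a f2 (last (pivot t.+1 a) (chain (ext a f2) t.+1 (pivot t.+1 a) (pivot t.+1 a))) t.+1 :: H2).
split=> //; first by rewrite phisS e1 d1.
  by rewrite phisS e2 d2.
by rewrite /= hx d4.
Qed.

(** * Order relation and cutting at a level *)

Lemma in_skewE a b r c : size b <= size a ->
  in_skew a b r c = (0 < c) && (inner_len a b r < c <= rowlen a r).
Proof. by move=> h; rewrite /in_skew in_shapeE in_innerE // -/(inner_len a b r); lia. Qed.

(** With shapes aligned at the bottom, both kinds of cover enlarge the diagram: a row is added on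
    top, or a row grows. *)
Lemma leqc_inner b a : leqc b a -> size b <= size a /\ forall r, inner_len a b r <= rowlen a r.
Proof.
have refl a0 : size a0 <= size a0 /\ forall r, inner_len a0 a0 r <= rowlen a0 r.
  by split=> // r; rewrite /inner_len subnn subn0.
elim=> {b a} [b a h|//|c b a _ [h1 h2] _ [h3 h4]].
- case: h => [->|[k [hk [-> _]]]].
    split=> //= r; rewrite /inner_len /= subSn // subnn.
    by case: r => //= r; rewrite subn1 /=; case: r.
  have sz : size (set_nth 0 b k (nth 0 b k).+1) = size b by rewrite size_set_nth; lia.
  split; first by rewrite sz.
  move=> r; rewrite /inner_len sz subnn subn0; case: r => //= r.
  by rewrite nth_set_nth /=; case: eqP => [->|].
- split; first by lia.
  move=> r; apply: leq_trans (h4 r); have := h2 (r - (size a - size b)).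
  by rewrite /inner_len (_ : r - _ - _ = r - (size a - size c)) //; lia.
Qed.

Lemma lel_min (g : nat -> letter) (s : seq nat) : s != [::] ->
  exists2 r, r \in s & forall r', r' \in s -> lel (g r) (g r').
Proof.
elim: s => [//|x s IH] _; case: (eqVneq s [::]) => [->|/IH [r rs hr]].
  by exists x => [|r']; rewrite inE // => /eqP ->; exact: lel_refl.
have [h|h] := boolP (lel (g x) (g r)).
  exists x; first exact: mem_head.
  move=> r'; rewrite inE => /orP[/eqP->|/hr]; first exact: lel_refl.
  exact: lel_trans.
exists r; first by rewrite inE rs orbT.
move=> r'; rewrite inE => /orP[/eqP->|/hr//].
by have := lel_total (g x) (g r); rewrite (negbTE h).
Qed.

Definition skew_box a b r c : bool := (0 < c) && (inner_len a b r < c <= rowlen a r).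

(* Removing a box with the smallest entry, at the end of its row, undoes a cover of the
   composition poset. *)
Lemma leqc_of_filling (n : nat) : forall (a b : seq nat) (f : filling), sumn a <= n ->
  composition a -> composition b -> size b <= size a ->
  (forall r, inner_len a b r <= rowlen a r) ->
  (forall r c, skew_box a b r c -> skew_box a b r c.+1 -> lel (f r c.+1) (f r c)) ->
  (forall r s, r < s -> skew_box a b r 1 -> skew_box a b s 1 -> ltl (f r 1) (f s 1)) ->
  (forall r s c, 0 < c -> r < s -> skew_box a b s c.+1 ->
     c <= inner_len a b r \/ skew_box a b r c /\ lel (f s c.+1) (f r c) ->
     c.+1 <= inner_len a b r \/ skew_box a b r c.+1 /\ ltl (f s c.+1) (f r c.+1)) ->
  leqc b a.
Proof.
elim: n => [|n IH] a b f hn ca cb hba hin hrow hcol htrip.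
  have a0 : a = [::].
    by case: a ca hn {hba hin hrow hcol htrip} => //= x s /andP[]; lia.
  have -> : b = [::] by apply: size0nil; move: hba; rewrite a0 /=; lia.
  by rewrite a0; apply: Relations.Relation_Operators.rt_refl.
set off := size a - size b.
set rows := [seq r <- iota 1 (size a) | inner_len a b r < rowlen a r].
have mem_rows r : (r \in rows) = (inner_len a b r < rowlen a r).
  rewrite mem_filter mem_iota; apply/idP/idP => [/andP[]//|h]; rewrite h /=.
  by have := @rowlen_size a r; lia.
have [e|ne] := eqVneq rows [::].
  have heq r : inner_len a b r = rowlen a r.
    by have := mem_rows r; rewrite e in_nil; have := hin r; lia.
  have off0 : off = 0.
    apply/eqP/negPn/negP => ho; have := heq 1; rewrite /inner_len -/off.
    rewrite (_ : 1 - off = 0) /=; last by lia.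
    by have := rowlen_gt0 ca (r := 1); rewrite /= /off in ho *; lia.
  have -> : b = a.
    apply: (@eq_from_nth _ 0); first by rewrite /off in off0; lia.
    by move=> k _; have := heq k.+1; rewrite /inner_len -/off off0 subn0.
  exact: Relations.Relation_Operators.rt_refl.
(* As rows decrease, a smallest entry among the row ends is smallest overall; its box is the one to
   remove. *)
have [r rin rmin] := lel_min (fun r => f r (rowlen a r)) ne.
have hr : inner_len a b r < rowlen a r by rewrite -mem_rows.
set m := f r (rowlen a r) in rmin.
have mmin s c : skew_box a b s c -> lel m (f s c).
  move=> /andP[c0 hc].
  have [k ek] : exists k, rowlen a s = c + k by exists (rowlen a s - c); lia.
  elim: k c c0 hc ek => [|k IHk] c c0 hc ek.
    by have := rmin s; rewrite mem_rows ek addn0 /=; apply; lia.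
  apply: lel_trans (IHk c.+1 _ _ _) _; try lia.
  by apply: hrow; rewrite /skew_box; lia.
have /rowlen_size/andP[r0 hra] : 0 < rowlen a r by lia.
have [l1|l1] := eqVneq (rowlen a r) 1.
  have roff : r <= off.
    rewrite leqNgt; apply/negP => h; have := rowlen_gt0 cb (r := r - off).
    by rewrite -/(inner_len a b r) /off in h *; lia.
  (* Otherwise the first entry of row [1] would be smaller than [m]. *)
  have r1 : r = 1.
    apply/eqP/negPn/negP => r1.
    have sk1 : skew_box a b 1 1.
      have := rowlen_gt0 ca (r := 1); rewrite /skew_box /inner_len -/off.
      by rewrite (_ : 1 - off = 0) /=; lia.
    have skr : skew_box a b r 1 by rewrite /skew_box; lia.
    have h1 := hcol 1 r ltac:(lia) sk1 skr.
    by have := mmin _ _ sk1; rewrite /m l1; letter_order.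
  have [a2 ea] : exists a2, a = 1 :: a2.
    by case: (a) hra l1 => [|x a2]; rewrite r1 //= => _ ->; exists a2.
  have szb : size b <= size a2 by move: roff hba; rewrite /off r1 ea /=; lia.
  have rl s : 0 < s -> rowlen a s.+1 = rowlen a2 s by rewrite ea; case: s.
  have einn s : inner_len a2 b s = inner_len a b s.+1.
    by rewrite /inner_len; congr rowlen; rewrite ea /=; lia.
  have inn1 : inner_len a b 1 = 0 by move: hr; rewrite r1 in l1 *; lia.
  have esk s c : skew_box a2 b s c = (0 < s) && skew_box a b s.+1 c.
    rewrite /skew_box einn; case: s => [|s]; last by rewrite rl.
    by rewrite inn1 /=; lia.
  rewrite {1}ea; apply: (@Relations.Relation_Operators.rt_trans _ _ _ a2); last first.
    by apply: Relations.Relation_Operators.rt_step; left.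
  apply: (IH a2 b (fun s c => f s.+1 c)) => //.
  - by move: hn; rewrite ea /=; lia.
  - by move: ca; rewrite ea.
  - by move=> [|s]; rewrite einn ?inn1 // -rl //; apply: hin.
  - by move=> s c; rewrite !esk => /andP[_ h1] /andP[_ h2]; apply: hrow.
  - by move=> s1 s2 h; rewrite !esk => /andP[_ h1] /andP[_ h2]; apply: hcol.
  move=> s1 s2 c c0 h; rewrite !esk !einn => /andP[_ h1] h2.
  have s10 : 0 < s1.
    case: s1 h2 {h} => // -[|[]] //; by rewrite inn1; lia.
  have [|h3|[h3 h4]] := htrip s1.+1 s2.+1 c c0 h h1.
  - by case: h2 => [h2|[/andP[_ h2] h3]]; [left|right].
  - by left.
  - by right; rewrite s10.
have [c ec] : exists c, rowlen a r = c.+1 by exists (rowlen a r).-1; lia.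
have c0 : 0 < c by lia.
have kr : r = r.-1.+1 by lia.
have en : nth 0 a r.-1 = c.+1 by move: ec; rewrite {1}kr.
set a2 := remove_box c.+1 r a.
have ea2 : a2 = set_nth 0 a r.-1 c by rewrite /a2 /remove_box /= (gtn_eqF c0).
have rl s : rowlen a2 s = shrink_row c.+1 r (rowlen a) s.
  by rewrite rowlen_remove // skip_row_id.
have sz2 : size a2 = size a by rewrite size_remove //; lia.
have einn s : inner_len a2 b s = inner_len a b s by rewrite /inner_len sz2.
apply: (@Relations.Relation_Operators.rt_trans _ _ _ a2); last first.
  apply: Relations.Relation_Operators.rt_step; right; exists r.-1; split; first by rewrite sz2; lia.
  have -> : nth 0 a2 r.-1 = c by rewrite ea2 nth_set_nth /= eqxx.
  split.
    apply: (@eq_from_nth _ 0); first by rewrite size_set_nth sz2; lia.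
    move=> k _; rewrite ea2 !nth_set_nth /=; case: eqP => [->|] //.
    by rewrite nth_set_nth /=; case: eqP.
  move=> s hs; apply/eqP => es.
  have {es} ls : rowlen a s.+1 = c by rewrite -es ea2 /= nth_set_nth /= ifF //; lia.
  have skr : skew_box a b r c.+1 by rewrite /skew_box; lia.
  (* As [m] is smallest, the triple condition would extend an earlier row of length [c] to column
     [c.+1]. *)
  have [|h|[h _]] := htrip s.+1 r c c0 ltac:(lia) skr.
  - have [h|h] := leqP c (inner_len a b s.+1); first by left.
    right; have sk : skew_box a b s.+1 c by rewrite /skew_box; lia.
    by split=> //; have := mmin _ _ sk; rewrite /m ec.
  - by have := hin s.+1; lia.
  - by move: h; rewrite /skew_box; lia.
have sk2 s d : skew_box a2 b s d -> skew_box a b s d.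
  by rewrite /skew_box einn rl /shrink_row; case: eqP => [->|]; lia.
apply: (IH a2 b f) => //.
- by rewrite ea2 sumn_set_nth0 en; lia.
- exact: (composition_remove _ ec).
- by rewrite sz2.
- by move=> s; rewrite einn rl /shrink_row; case: eqP => [->|_]; [lia|exact: hin].
- by move=> s d /sk2 h1 /sk2 h2; apply: hrow.
- by move=> s1 s2 h /sk2 h1 /sk2 h2; apply: hcol.
move=> s1 s2 d d0 h /sk2 h1; rewrite einn => h2.
have [|h3|[h3 h4]] := htrip s1 s2 d d0 h h1.
- by case: h2 => [h2|[/sk2 h2 h3]]; [left|right].
- by left.
(* The removed box is never the one demanded here: its entry would have to exceed another one. *)
right; split=> //; move: h3; rewrite /skew_box einn rl /shrink_row; case: eqP => [es|//] h3.
have [ed|nd] := eqVneq d.+1 c.+1; last by move: h3; rewrite es; lia.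
by have := mmin _ _ h1; move: h4; rewrite es ed /m ec; letter_order.
Qed.

Lemma skew_boxE a b r c : size b <= size a -> in_skew a b r c = skew_box a b r c.
Proof. exact: in_skewE. Qed.

Lemma inner_boxE a b r c : size b <= size a -> in_inner a b r c = (0 < c <= inner_len a b r).
Proof. exact: in_innerE. Qed.

Lemma ssrct_skew a b f : ssrct a b f ->
  [/\ size b <= size a, forall r, inner_len a b r <= rowlen a r,
    forall r c, skew_box a b r c -> is_letter (f r c),
    forall r c, skew_box a b r c -> skew_box a b r c.+1 -> lel (f r c.+1) (f r c) &
    forall r s, r < s -> skew_box a b r 1 -> skew_box a b s 1 -> ltl (f r 1) (f s 1)] /\
  forall r s c, 0 < c -> r < s -> skew_box a b s c.+1 ->
     c <= inner_len a b r \/ skew_box a b r c /\ lel (f s c.+1) (f r c) ->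
     c.+1 <= inner_len a b r \/ skew_box a b r c.+1 /\ ltl (f s c.+1) (f r c.+1).
Proof.
move=> [[ca cb hba h1] [h2 h3 h4]]; have [sz hin] := leqc_inner hba; split; first split=> //.
- by move=> r c; rewrite -skew_boxE //; apply: h1.
- by move=> r c; rewrite -!skew_boxE //; apply: h2.
- by move=> r s hrs; rewrite -!skew_boxE //; apply: h3.
move=> r s c c0 hrs; rewrite -!skew_boxE // => hs h; have := h4 r s c c0 hrs hs.
rewrite !inner_boxE // c0 /= => h5.
have [|->|/andP[h6 h7]] := orP (h5 _); [|by left|by right].
by case: h => [->//|[-> ->]]; rewrite orbT.
Qed.

(** The order relation between the shapes is not assumed; it comes from the filling. *)
Lemma ssrct_of_skew a b f : composition a -> composition b -> size b <= size a ->
  (forall r, inner_len a b r <= rowlen a r) ->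
  (forall r c, skew_box a b r c -> is_letter (f r c)) ->
  (forall r c, skew_box a b r c -> skew_box a b r c.+1 -> lel (f r c.+1) (f r c)) ->
  (forall r s, r < s -> skew_box a b r 1 -> skew_box a b s 1 -> ltl (f r 1) (f s 1)) ->
  (forall r s c, 0 < c -> r < s -> skew_box a b s c.+1 ->
     c <= inner_len a b r \/ skew_box a b r c /\ lel (f s c.+1) (f r c) ->
     c.+1 <= inner_len a b r \/ skew_box a b r c.+1 /\ ltl (f s c.+1) (f r c.+1)) ->
  ssrct a b f.
Proof.
move=> ca cb sz hin hlet hrow hcol htrip; split; first split=> //.
- exact: (leqc_of_filling (leqnn _) ca cb sz hin hrow hcol htrip).
- by move=> r c; rewrite skew_boxE //; apply: hlet.
split.
- by move=> r c; rewrite !skew_boxE //; apply: hrow.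
- by move=> r s hrs; rewrite !skew_boxE //; apply: hcol.
move=> r s c c0 hrs; rewrite !skew_boxE // !inner_boxE // c0 /= => hs h.
have [|->|[-> ->]] := htrip r s c c0 hrs hs; rewrite ?orbT //.
by case/orP: h => [|/andP[]]; [left|right].
Qed.

Lemma ssrct_congr a b f g : ssrct a b f -> (forall r c, in_skew a b r c -> f r c = g r c) ->
  ssrct a b g.
Proof.
move=> [[ca cb hba h1] [h2 h3 h4]] e; split; first split=> //.
- by move=> r c h; rewrite -e //; apply: h1.
split.
- by move=> r c h h'; rewrite -!e //; apply: h2.
- by move=> r s hrs h h'; rewrite -!e //; apply: h3.
move=> r s c c0 hrs hs h; have := h4 r s c c0 hrs hs.
have -> : in_skew a b r c && lel (f s c.+1) (f r c) = in_skew a b r c && lel (g s c.+1) (g r c).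
  by case: (boolP (in_skew a b r c)) => // h'; rewrite !e.
have -> : in_skew a b r c.+1 && ltl (f s c.+1) (f r c.+1) =
    in_skew a b r c.+1 && ltl (g s c.+1) (g r c.+1).
  by case: (boolP (in_skew a b r c.+1)) => // h'; rewrite !e.
exact.
Qed.

Section Cut.
Variables (a b : seq nat) (W : filling) (z : letter).
Hypotheses (ca : composition a) (cb : composition b) (sz : size b <= size a).
Hypotheses (hW : tableau_rows (rowlen a) W) (hM : level z W (inner_len a b)).

(** Inner boxes hold letters above [z], hence above every remaining entry, so they satisfy the
    premise of the triple condition as the skew version requires. *)
Lemma ssrct_below_level : ssrct a b W.
Proof.
have pos r c : ltl z (W r c) -> ltl zero (W r c) by letter_order.
have hin r : inner_len a b r <= rowlen a r.
  have [->//|i0] := posnP (inner_len a b r).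
  have := pos r (inner_len a b r); rewrite hM (tab_supp hW); lia.
have skewE r c : skew_box a b r c = ltl zero (W r c) && ~~ ltl z (W r c).
  by rewrite hM (tab_supp hW) /skew_box; lia.
apply: ssrct_of_skew => //.
- move=> r c; rewrite skewE => /andP[h _].
  by case: (tab_letter hW r c) => // e; rewrite e in h.
- by move=> r c /andP[c0 _] _; apply: (tab_row hW).
- by move=> r s hrs; rewrite !skewE => /andP[h _] /andP[h' _]; apply: (tab_col1 hW).
move=> r s c c0 hrs; rewrite !skewE => /andP[h1 h2] h.
have hle : lel (W s c.+1) (W r c).
  case: h => [h|[]//]; have : ltl z (W r c) by rewrite hM c0.
  by letter_order.
have hlt := tab_triple hW c0 hrs h1 hle.
have [h3|h3] := boolP (ltl z (W r c.+1)); first by left; move: h3; rewrite hM.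
by right; rewrite hlt; split=> //; letter_order.
Qed.

Lemma tab_above_level : tableau_rows (rowlen b)
  (fun r c => if ltl z (W (r + (size a - size b)) c) then W (r + (size a - size b)) c else zero).
Proof.
set off := size a - size b.
have e r c : ltl zero (if ltl z (W (r + off) c) then W (r + off) c else zero) = ltl z (W (r + off) c).
  by case: ifP => h; [letter_order|].
split=> //.
- by move=> r c; case: ifP => _; [exact: (tab_letter hW)|left].
- by move=> r c; rewrite e hM /inner_len addnK.
- move=> r c c0; have := tab_row hW (r + off) c0.
  by case: ifP => h; case: ifP => h' //; letter_order.
- move=> r s hrs; rewrite !e => h1 h2; rewrite h1 h2; apply: (tab_col1 hW); [lia| |]; letter_order.
move=> r s c c0 hrs; rewrite e => h1; rewrite h1 => h2.
have h3 : lel (W (s + off) c.+1) (W (r + off) c).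
  by move: h2; case: ifP => // _; letter_order.
have h4 : ltl (W (s + off) c.+1) (W (r + off) c.+1).
  by apply: (tab_triple hW) => //; [lia|letter_order].
by case: ifP => // h5; letter_order.
Qed.

End Cut.

(** * Gluing the inner and the outer filling *)

Lemma rowlen_nil r : rowlen [::] r = 0.
Proof. by case: r => //= r; rewrite nth_nil. Qed.

Section Glue.
Variables (alpha beta : seq nat) (to tb : filling).
Hypotheses (hto : ssrct alpha beta to) (htb : ssrct beta [::] tb).
Hypothesis to_unbarred : forall r c, in_skew alpha beta r c -> ~~ barred (to r c).
Hypothesis tb_barred : forall r c, in_shape beta r c -> barred (tb r c).
Let F := ext alpha (glue alpha beta to tb).
Let off := size alpha - size beta.
Let inn := inner_len alpha beta.
Let sz : size beta <= size alpha. Proof. by case: (ssrct_skew hto) => -[]. Qed.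
Let inn_le r : inn r <= rowlen alpha r. Proof. by case: (ssrct_skew hto) => -[]. Qed.

Lemma ext_glue r c : F r c = if 0 < c <= inn r then tb (r - off) c
  else if 0 < c <= rowlen alpha r then to r c else zero.
Proof.
rewrite /F /ext /glue in_shapeE in_innerE // -/(inner_len alpha beta r) -/inn.
by have := inn_le r; case: ifP => h; case: ifP => h' //; lia.
Qed.

Lemma glue_spec r c :
  [\/ [/\ 0 < c <= inn r, F r c = tb (r - off) c, barred (F r c) & is_letter (F r c)],
      [/\ skew_box alpha beta r c, F r c = to r c, ~~ barred (F r c) & is_letter (F r c)] |
      [/\ ~~ (0 < c <= rowlen alpha r) & F r c = zero]].
Proof.
rewrite ext_glue; case: ifP => h.
  have sk : skew_box beta [::] (r - off) c.
    by rewrite /skew_box /inner_len rowlen_nil; move: h; rewrite /inn /inner_len -/off; lia.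
  constructor 1; split=> //; first by apply: tb_barred; rewrite in_shapeE.
  by case: (ssrct_skew htb) => -[_ _ h' _ _ _]; apply: h'.
case: ifP => h'; last by constructor 3.
have sk : skew_box alpha beta r c by rewrite /skew_box -/(inn r); lia.
constructor 2; split=> //; first by apply: to_unbarred; rewrite in_skewE.
by case: (ssrct_skew hto) => -[_ _ h2 _ _ _]; apply: h2.
Qed.

Lemma level_glue : level bar0 F inn.
Proof.
move=> r c; case: (glue_spec r c) => [[h _ h1 h2]|[h _ h1 h2]|[h ->]].
- by rewrite -barred_level ?h1 ?h //; right.
- by rewrite -barred_level; [move: h; rewrite (negbTE h1) /skew_box -/inn; lia|right].
- by have := inn_le r; rewrite (_ : ltl bar0 zero = false) //; lia.
Qed.

Lemma letter_lt x y : ~~ barred x -> barred y -> ltl x y.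
Proof. by case: x y => [[] m] [[] n]. Qed.

(** Each condition is inherited from [tb] between barred entries and from [to] between unbarred
    ones; mixed pairs are settled by barred letters exceeding unbarred ones. *)
Lemma tab_glue : tableau_rows (rowlen alpha) F.
Proof.
have [[_ _ hl1 hr1 hc1] ht1] := ssrct_skew hto.
have [[_ _ hl2 hr2 hc2] ht2] := ssrct_skew htb.
have bE r c : barred (F r c) = (0 < c <= inn r).
  case: (glue_spec r c) => [[h _ h1 h2]|[h _ h1 h2]|[h ->]]; first by rewrite h1 h.
    by move: h; rewrite (negbTE h1) /skew_box -/inn; lia.
  by have := inn_le r; rewrite (_ : barred zero = false) //; lia.
have supp r c : ltl zero (F r c) = (0 < c <= rowlen alpha r).
  case: (glue_spec r c) => [[h _ _ h1]|[h _ _ h1]|[h ->]].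
  - by have := inn_le r; rewrite (_ : ltl zero _ = true); [lia|case: (F r c) h1 => [[] []]].
  - by rewrite (_ : ltl zero _ = true); [move: h; rewrite /skew_box; lia|case: (F r c) h1 => [[] []]].
  - by rewrite (negbTE h).
have sk2 r c : 0 < c <= inn r -> skew_box beta [::] (r - off) c.
  by rewrite /skew_box /inn /inner_len rowlen_nil -/off; lia.
have sk1 r c : ltl zero (F r c) -> ~~ barred (F r c) -> skew_box alpha beta r c.
  by rewrite supp bE /skew_box -/(inn r); lia.
have eb r c : barred (F r c) -> F r c = tb (r - off) c by move=> h; rewrite ext_glue -bE h.
have eo r c : ltl zero (F r c) -> ~~ barred (F r c) -> F r c = to r c.
  by move=> h /negbTE h'; rewrite ext_glue -bE h' -supp h.
have inn_off r : 0 < inn r -> off < r.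
  by rewrite /inn /inner_len -/off => /rowlen_size; lia.
split=> //.
- by move=> r c; case: (glue_spec r c) => [[_ _ _ h]|[_ _ _ h]|[_ h]]; [right|right|left].
- move=> r c c0; have [b1|b1] := boolP (barred (F r c.+1)).
    have b2 : barred (F r c) by move: b1; rewrite !bE; lia.
    by rewrite (eb _ _ b1) (eb _ _ b2); apply: hr2; apply: sk2; rewrite -bE.
  have [b2|b2] := boolP (barred (F r c)); first by have := letter_lt b1 b2; letter_order.
  have [p1|p1] := boolP (ltl zero (F r c.+1)); last by letter_order.
  have p2 : ltl zero (F r c) by move: p1; rewrite !supp; lia.
  by rewrite (eo _ _ p1 b1) (eo _ _ p2 b2); apply: hr1; apply: sk1.
- move=> r s hrs p1 p2; have [b1|b1] := boolP (barred (F r 1)).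
    (* The inner rows occupy the bottom of the diagram and none is empty. *)
    have b2 : barred (F s 1).
      have hoff : off < r by apply: inn_off; move: b1; rewrite bE; lia.
      have := rowlen_size (a := alpha) (r := s); move: p2; rewrite supp bE => p2 hs.
      have [_ cb _ _] := proj1 htb; have : 0 < rowlen beta (s - off).
        case: (proj1 hto) => _ cb' _ _; apply: rowlen_gt0 => //; rewrite /off in hoff *; lia.
      by rewrite /inn /inner_len -/off => ->.
    rewrite (eb _ _ b1) (eb _ _ b2); apply: hc2; [|apply: sk2; by rewrite -bE|apply: sk2; by rewrite -bE].
    by have := inn_off r; move: b1; rewrite bE; lia.
  have [b2|b2] := boolP (barred (F s 1)); first exact: letter_lt.
  by rewrite (eo _ _ p1 b1) (eo _ _ p2 b2); apply: hc1 => //; apply: sk1.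
move=> r s c c0 hrs p1 le1; have p2 : ltl zero (F r c) by letter_order.
have [b1|b1] := boolP (barred (F s c.+1)).
  have b2 : barred (F r c) by apply: barred_lel b1 le1.
  have hoff : off < r by apply: inn_off; move: b2; rewrite bE; lia.
  have k1 : skew_box beta [::] (s - off) c.+1 by apply: sk2; rewrite -bE.
  have k2 : skew_box beta [::] (r - off) c by apply: sk2; rewrite -bE.
  have lt_off : r - off < s - off by move: hoff hrs; clear; lia.
  have [|h|[h1 h2]] := ht2 (r - off) (s - off) c c0 lt_off k1.
  - by right; rewrite -(eb _ _ b1) -(eb _ _ b2).
  - by move: h; rewrite /inner_len rowlen_nil.
  - have b3 : barred (F r c.+1).
      by move: h1; rewrite bE /inn /inner_len -/off /skew_box; lia.
    by rewrite (eb _ _ b1) (eb _ _ b3).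
have [|h|[h1 h2]] := ht1 r s c c0 hrs (sk1 _ _ p1 b1).
- have [b2|b2] := boolP (barred (F r c)); first by left; move: b2; rewrite bE => /andP[].
  by right; split; [apply: sk1|rewrite -(eo _ _ p1 b1) -(eo _ _ p2 b2)].
- by apply: letter_lt => //; rewrite bE.
have [p3 b3] : ltl zero (F r c.+1) /\ ~~ barred (F r c.+1).
  by rewrite supp bE; move: h1; rewrite /skew_box -/(inn r); lia.
by rewrite (eo _ _ p1 b1) (eo _ _ p3 b3).
Qed.

End Glue.

(** * The tableau gamma *)

Lemma count_rows (P : pred nat) (a : seq nat) :
  count (fun r => P (rowlen a r)) (iota 1 (size a)) = count P a.
Proof.
rewrite -[in RHS](mkseq_nth 0 a) /mkseq count_map -[1]addn0 iotaDl count_map.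
exact: eq_count.
Qed.

Lemma above_zero a F q : tableau_rows (rowlen a) F -> 0 < q -> above a F q zero = collen a q.
Proof.
move=> hF q0; rewrite /collen -count_rows; apply: eq_count => r.
by rewrite (tab_supp hF) q0.
Qed.

Lemma addable_mem a i : addable a i -> 0 < i.-1 -> i.-1 \in a.
Proof.
move=> h i0; have {h} : collen a i < collen a i.-1 by case/orP: h => [/eqP e|/andP[]//]; rewrite e in i0.
rewrite /collen => h; apply/negPn/negP => na; move: h; rewrite ltnNge => /negP[].
rewrite (@eq_in_count _ _ (fun x => i <= x)) // => x xa.
have ne : x != i.-1 by apply: contraNneq na => <-.
by move: ne i0; clear; lia.
Qed.

Lemma nth_unbar (s : seq letter) k : unbar (nth zero s k) = nth (unbar zero) (map unbar s) k.
Proof.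
have [h|h] := ltnP k (size s); first by rewrite (nth_map zero).
by rewrite !nth_default // size_map.
Qed.

Lemma sort_rev_sorted H : sorted lel H -> sort (fun x y => lel y x) H = rev H.
Proof.
move=> hs; apply: (@sorted_eq _ (fun x y => lel y x)).
- by move=> y x z h1 h2; apply: lel_trans h2 h1.
- by move=> x y /andP[h1 h2]; apply: lel_anti.
- by apply: sort_sorted => x y; apply: lel_total.
- by rewrite rev_sorted.
- by rewrite perm_sort perm_sym perm_rev.
Qed.

Lemma rowlen_rcons a x r : rowlen (rcons a x) r = if r == (size a).+1 then x else rowlen a r.
Proof.
case: r => [//|r] /=; rewrite eqSS nth_rcons; case: ltngtP => // h.
by rewrite nth_default // ltnW.
Qed.

Section Assembly.
Variables (t : nat) (a1 b1 : seq nat) (F : filling) (H : seq letter).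
Hypotheses (ca : composition a1) (cb : composition b1) (sz : size b1 <= size a1).
Hypotheses (hF : tableau_rows (rowlen a1) F) (hM : level bar0 F (inner_len a1 b1)).
Hypotheses (sH : size H = t) (letH : all is_letter H) (sortedH : sorted lel H).
Hypothesis sepH : forall q r, 0 < q <= t -> lel (nth zero H (t - q)) (F r q) ->
  ltl (nth zero H (t - q)) (F r q.+1).
Let j := count barred H.
Let X := rcons b1 j.+1.
Let Y := rcons a1 t.+1.
Let N := size a1.
(** Rows and the list of exits decrease, so their first entries suffice for a bound. Every entry is
    at most [mid], and only the placeholder [top] exceeds it: the level [mid] is the single box
    standing for the empty one. *)
Let M := (nth zero (rev H) 0).2 + \max_(r < N.+1) (F r 1).2.
Let mid : letter := (true, M).
Let top : letter := (true, M.+1).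

(* The new row of the tableau, with the empty box filled by a letter exceeding all entries. *)
Definition completion : filling := fun r c =>
  if r == N.+1 then (if c == 0 then zero else if c == 1 then top else nth zero (rev H) (c - 2))
  else F r c.
Let W := completion.

Let F_out r c : N < r -> F r c = zero.
Proof.
move=> h; apply: (tab_zero hF); rewrite (tab_supp hF).
by have := @rowlen_size a1 r; rewrite -/N; move: h; clear; lia.
Qed.

Let F_col0 r : F r 0 = zero.
Proof. by apply: (tab_zero hF); rewrite (tab_supp hF). Qed.

Let F_le_mid r c : lel (F r c) mid.
Proof.
have [h|h] := ltnP N r; first by rewrite F_out //; letter_order.
have h1 : lel (F r 1) mid.
  have : (F r 1).2 <= M.
    apply: leq_trans (leq_addl _ _); have hr : r < N.+1 by [].
    exact: (leq_bigmax (Ordinal hr)).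
  by case: (F r 1) => [[] m]; rewrite /lel /mid.
case: c => [|c]; first by rewrite F_col0; letter_order.
by elim: c => // c IH; apply: lel_trans IH; apply: (tab_row hF).
Qed.

Let sorted_rev : sorted (fun x y => lel y x) (rev H).
Proof. by rewrite rev_sorted. Qed.

Let nth_dec k : lel (nth zero (rev H) k.+1) (nth zero (rev H) k).
Proof.
have [h|h] := ltnP k.+1 (size (rev H)); last by rewrite (nth_default _ h); letter_order.
apply: (@sorted_ltn_nth _ (fun x y => lel y x)) => //.
  by move=> y x z h1 h2; apply: lel_trans h2 h1.
by rewrite inE; apply: ltnW.
Qed.

Let nth_le_mid k : lel (nth zero (rev H) k) mid.
Proof.
elim: k => [|k IH]; last by apply: lel_trans (nth_dec k) IH.
have : (nth zero (rev H) 0).2 <= M by apply: leq_addr.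
by case: (nth zero (rev H) 0) => [[] m]; rewrite /lel /mid.
Qed.

Let nth_letter k : nth zero (rev H) k = zero /\ t <= k \/ is_letter (nth zero (rev H) k) /\ k < t.
Proof.
have [h|h] := ltnP k t; last by left; rewrite nth_default ?size_rev ?sH.
by right; split=> //; apply: (allP letH); rewrite -mem_rev mem_nth // size_rev sH.
Qed.

Let letter_pos x : is_letter x -> ltl zero x.
Proof. by case: x => [[] []]. Qed.

Let top_mid : ltl mid top. Proof. by rewrite /ltl /lel /= -ltnNge. Qed.

Lemma tab_completion : tableau_rows (rowlen Y) W.
Proof.
split.
- move=> r c; rewrite /W /completion; case: ifP => _; last exact: (tab_letter hF).
  case: ifP => _; first by left.
  case: ifP => _; first by right.
  by case: (nth_letter (c - 2)) => -[h _]; [left|right].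
- move=> r c; rewrite /W /completion rowlen_rcons -/N; case: ifP => _; last exact: (tab_supp hF).
  case: c => [|[|c]] //=; rewrite subSS subSS subn0.
  have -> : (c.+1 < t.+1) = (c < t) by [].
  case: (nth_letter c) => [[-> h]|[/letter_pos -> -> //]].
  by rewrite ltnNge h /ltl lel_refl.
- by rewrite rowlen_rcons.
- move=> r c c0; rewrite /W /completion; case: ifP => _; last exact: (tab_row hF).
  case: c c0 => [//|[|c]] _ /=; first by apply: lel_trans (nth_le_mid _) _; move: top_mid; letter_order.
  by rewrite !subSS !subn0.
- move=> r s hrs; rewrite /W /completion; case: (eqVneq r N.+1) => [e|nr].
    have ns : (s == N.+1) = false by rewrite -e gtn_eqF.
    rewrite ns => _; rewrite F_out; last by apply: ltnW; rewrite -e.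
    by letter_order.
  case: (eqVneq s N.+1) => [e|ns] /=; last exact: (tab_col1 hF).
  by have := F_le_mid r 1; move: top_mid; letter_order.
move=> r s c c0 hrs; rewrite /W /completion; case: (eqVneq r N.+1) => [e|nr].
  have ns : (s == N.+1) = false by rewrite -e gtn_eqF.
  by rewrite ns F_out; [letter_order|apply: ltnW; rewrite -e].
case: (eqVneq s N.+1) => [e|ns] /=; last exact: (tab_triple hF).
case: c c0 => [//|c] _ /=; rewrite subSS subSS subn0 => pos.
have ct : c < t by case: (nth_letter c) => -[h //]; move: pos; rewrite h.
(* [H] lists the exits from column [t] down to column [1], so the box in column [c.+2] of the new
   row holds the entry that left column [c.+1]. *)
have e1 : nth zero (rev H) c = nth zero H (t - c.+1) by rewrite nth_rev sH.
by rewrite e1; apply: sepH.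
Qed.

(** The [j] barred exits come first in the decreasing row; with the placeholder they fill the
    columns up to [j.+1], the last part of [X]. *)
Let letter_barred k : barred (nth zero (rev H) k) = (k < j).
Proof.
rewrite barred_level; last by case: (nth_letter k) => -[h _]; [left|right].
rewrite (nth_sorted_above _ sorted_rev (k := k.+1)) // count_rev; congr (_ < _).
apply: eq_in_count => x xH; rewrite -barred_level //; right; exact: (allP letH).
Qed.

Lemma size_XY : size Y - size X = size a1 - size b1.
Proof. by rewrite !size_rcons subSS. Qed.

Let inner_XY r : inner_len Y X r = if r == N.+1 then j.+1 else inner_len a1 b1 r.
Proof.
rewrite /inner_len size_XY rowlen_rcons; congr (if _ then _ else _).
by rewrite /N; move: sz; clear; lia.
Qed.

Lemma level_completion : level bar0 W (inner_len Y X).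
Proof.
move=> r c; rewrite inner_XY /W /completion; case: ifP => _; last exact: hM.
case: c => [|[|c]] //=; rewrite subSS subSS subn0 -barred_level ?letter_barred //.
by case: (nth_letter c) => -[h _]; [left|right].
Qed.

Lemma level_top : level mid W (inner_len Y [:: 1]).
Proof.
move=> r c; rewrite /inner_len size_rcons /= subn1 /= -/N /W /completion.
have -> : rowlen [:: 1] (r - N) = (r == N.+1).
  by case E : (r - N) => [|[|k]] /=; rewrite ?nth_nil; move: E; clear; case: eqP; lia.
case: ifP => _; last first.
  by have := F_le_mid r c; rewrite /ltl => ->; case: c.
case: c => [|[|c]] //=.
by rewrite subSS subSS subn0; have := nth_le_mid c; rewrite /ltl => ->.
Qed.

Let compX : composition X. Proof. by rewrite /composition all_rcons; exact: cb. Qed.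
Let compY : composition Y. Proof. by rewrite /composition all_rcons; exact: ca. Qed.
Let szX : size X <= size Y. Proof. by rewrite !size_rcons. Qed.

Lemma ssrct_completion : ssrct Y X W.
Proof. exact: (ssrct_below_level compY compX szX tab_completion level_completion). Qed.

(** Two cuts: at [bar0] to keep the barred part, then at [mid], which makes the placeholder box the
    inner shape. *)
Lemma ssrct_completion_barred : ssrct X [:: 1] (fun r c => W (r + (size Y - size X)) c).
Proof.
have hX := tab_above_level compY compX szX tab_completion level_completion.
set V := (fun r c => if _ then _ else _) in hX.
have lV : level mid V (inner_len X [:: 1]).
  move=> r c; have := level_top (r + (size Y - size X)) c.
  rewrite (_ : inner_len Y _ _ = inner_len X [:: 1] r); last first.
    rewrite /inner_len; congr rowlen; move: sz; rewrite !size_rcons /=; clear; lia.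
  move=> <-; rewrite /V; case: ifP => // h.
  have : lel bar0 mid by rewrite /lel.
  by move: h => /negbT; rewrite /ltl negbK => h h2; apply/idP/idP; letter_order.
have sX : size [:: 1] <= size X by rewrite size_rcons.
have c1 : composition [:: 1] by [].
apply: (ssrct_congr (ssrct_below_level compX c1 sX hX lV)) => r c.
rewrite in_skewE // => /andP[c0 hc]; rewrite /V ifT //.
rewrite level_completion c0 /inner_len addnK; by case/andP: hc.
Qed.

Lemma barred_cell r c : in_shape Y r c -> in_inner Y X r c =
  ((r == size Y) && (c == 1)) || (in_skew Y [:: 1] r c && barred (W r c)).
Proof.
move=> hs; rewrite inner_boxE // -level_completion.
have sY : size [:: 1] <= size Y by rewrite size_rcons.
have eS : in_skew Y [:: 1] r c = ~~ ((r == size Y) && (c == 1)).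
  rewrite /in_skew hs inner_boxE // -level_top /W /completion size_rcons -/N.
  case: (eqVneq r N.+1) => _ /=; last by rewrite negbK; apply: F_le_mid.
  case: c hs => [|[|c]] hs //=.
    by rewrite top_mid.
  by rewrite subSS subSS subn0 /ltl negbK nth_le_mid.
rewrite eS; case: (boolP ((r == size Y) && _)) => [/andP[/eqP -> /eqP ->]|_] /=.
  by rewrite /W /completion size_rcons -/N !eqxx.
by rewrite barred_level //; apply: (tab_letter tab_completion).
Qed.

Lemma completion_skew f r c : (forall r c, F r c = ext a1 f r c) -> in_skew Y [:: 1] r c ->
  W r c = if r <= size a1 then f r c else nth zero (rev H) (c - 2).
Proof.
move=> eF; rewrite in_skewE ?size_rcons // => /andP[c0 hc].
rewrite /W /completion -/N; case: (eqVneq r N.+1) => [er|nr].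
  rewrite er ltnn (gtn_eqF c0) ifF //.
  by move: hc; rewrite er /inner_len size_rcons /= subn1 /= -/N subSnn /=; clear; lia.
have hr : r <= N.
  by have := @rowlen_size Y r; rewrite size_rcons -/N; move: hc nr; clear; lia.
rewrite hr eF /ext in_shapeE c0; move: hc; rewrite rowlen_rcons -/N (negbTE nr) => /andP[_ ->].
by [].
Qed.

End Assembly.

Lemma phis_glue (alpha beta : seq nat) (to tb : filling) (i : nat) :
  composition alpha -> composition beta -> ssrct alpha beta to ->
  (forall r c, in_skew alpha beta r c -> ~~ barred (to r c)) ->
  ssrct beta [::] tb -> (forall r c, in_shape beta r c -> barred (tb r c)) ->
  0 < i -> addable alpha i ->
  let tau := glue alpha beta to tb in
  exists a1 f1 H b1,
  [/\ phis i.-1 (alpha, tau) = ((a1, f1), H), vdown i.-1 alpha = Some a1, composition a1 &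
      tableau_rows (rowlen a1) (ext a1 f1)] /\
  [/\ vdown (count barred H) beta = Some b1, composition b1, size b1 <= size a1 &
      level bar0 (ext a1 f1) (inner_len a1 b1)] /\
  [/\ size H = i.-1, all is_letter H, sorted lel H &
      jbar (jdt_moves alpha (rho alpha tau) i) = count barred H] /\
  (forall q r, 0 < q <= i.-1 -> lel (nth zero H (i.-1 - q)) (ext a1 f1 r q) ->
      ltl (nth zero H (i.-1 - q)) (ext a1 f1 r q.+1)).
Proof.
move=> ca cb hto hun htb hbar; case: i => // t _ hadd tau.
have hF := tab_glue hto htb hun hbar.
have hM := level_glue hto htb hun hbar.
have [[sz _ _ _ _] _] := ssrct_skew hto.
set p := (collen alpha t.+1).+1; set T := rho alpha tau.
(* The slide starts at an addable node, outside the shape, so the extra terms of the invariant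
   vanish. *)
have Tp : T p t.+1 = zero.
  apply: lel_anti (lel0 _); have := rho_above alpha tau zero (isT : 0 < t.+1) (isT : 0 < p).
  by rewrite (above_zero hF) // /p ltnn => /negbT; rewrite negbK.
have zero_min z : ltl z zero = false by rewrite /ltl lel0.
have [|a1 [f1 [H [b1 [h1 [h2 [[h3 h4 h5 h6] [_ h7]]]]]]]] :=
  phis_spec (T := T) (p := p) (n := p + t.+1) ca hF (addable_mem hadd) cb sz hM.
  move=> t0; split; [by rewrite leq_add2l| |by move=> z; rewrite Tp zero_min].
  split=> //.
  - by move=> z q k /andP[q0 _] k0; apply: rho_above.
  - by move=> z k k0; rewrite Tp zero_min addn0; apply: rho_above.
  - by move=> z; rewrite Tp zero_min addn0; apply: above_le hF t0.
by exists a1, f1, H, b1; do !split=> //; apply: path_sorted h5.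
Qed.

Theorem theorem7p7 (alpha beta : seq nat) (to tb : filling) (i : nat) :
  composition alpha -> composition beta -> leqc beta alpha ->
  ssrct alpha beta to ->
  (forall r c, in_skew alpha beta r c -> ~~ barred (to r c)) ->
  ssrct beta [::] tb ->
  (forall r c, in_shape beta r c -> barred (tb r c)) ->
  0 < i -> addable alpha i ->
  let tau := glue alpha beta to tb in
  let j := jbar (jdt_moves alpha (rho alpha tau) i) in
  let gamma := mu i (alpha, tau) in
  exists X Y : seq nat,
    [/\ uop j.+1 beta = Some X, uop i alpha = Some Y, gamma.1 = Y &
     (forall r c, in_shape Y r c ->
        in_inner Y X r c =
        ((r == size Y) && (c == 1)) || (in_skew Y [:: 1] r c && barred (gamma.2 r c)))] /\
    [/\
     ssrct X [:: 1] (fun r c => gamma.2 (r + (size Y - size X)) c),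
     ssrct Y X gamma.2
   & forall tb' : filling,
       ssrct beta [::] tb' -> (forall r c, in_shape beta r c -> barred (tb' r c)) ->
       forall r c, Apart (mu i (alpha, glue alpha beta to tb')) r c = Apart gamma r c].
Proof.
move=> ca cb _ hto hun htb hbar i0 hadd tau j gamma.
have [a1 [f1 [H [b1 [[e1 e2 ca1 hF] [[e3 cb1 sz hM] [[sH letH sortH ej] sepH]]]]]]] :=
  phis_glue ca cb hto hun htb hbar i0 hadd.
have it : i = i.-1.+1 by rewrite prednK.
rewrite -/tau -/j in e1 ej.
have eg : gamma = (rcons a1 i, fun r c => if r <= size a1 then f1 r c else nth zero (rev H) (c - 2)).
  by rewrite /gamma /mu e1 (sort_rev_sorted sortH).
set Y := rcons a1 i.-1.+1; set X := rcons b1 (count barred H).+1.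
have eY : gamma.1 = Y by rewrite eg /Y -it.
pose W := completion a1 (ext a1 f1) H.
have eW r c : in_skew Y [:: 1] r c -> W r c = gamma.2 r c.
  by move=> h; rewrite eg; apply: (completion_skew (a1 := a1) (F := ext a1 f1) (f := f1) H (fun _ _ => erefl) h).
have sXY : ssrct Y X W := ssrct_completion ca1 cb1 sz hF hM sH letH sortH sepH.
have sX1 := ssrct_completion_barred ca1 cb1 sz hF hM sH letH sortH sepH.
have [[szX hin _ _ _] _] := ssrct_skew sXY.
have [[sz1 hin1 _ _ _] _] := ssrct_skew sX1.
have szY : size [:: 1] <= size Y by rewrite size_rcons.
have inn1 r : inner_len X [:: 1] (r - (size Y - size X)) = inner_len Y [:: 1] r.
  by rewrite /inner_len; congr rowlen; move: szX; rewrite /X /Y !size_rcons /=; clear; lia.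
exists X, Y; split; split=> //.
- by rewrite /uop ej e3.
- by rewrite /uop e2 /= /Y -it.
- move=> r c hs; rewrite (barred_cell sz hF hM sH letH sortH sepH hs) -/Y -/W.
  by congr (_ || _); case: (boolP (in_skew Y [:: 1] r c)) => //= h; rewrite eW.
- apply: (ssrct_congr sX1) => r c; rewrite in_skewE // => /andP[c0 hc]; apply: eW.
  rewrite in_skewE // c0 -inn1 addnK; move: hc => /andP[-> hc] /=.
  by apply: leq_trans hc _; have := hin (r + (size Y - size X)); rewrite /inner_len addnK.
- apply: (ssrct_congr sXY) => r c; rewrite in_skewE // => /andP[c0 /andP[h1 h2]]; apply: eW.
  rewrite in_skewE // c0 h2 andbT -inn1; apply: leq_ltn_trans h1; exact: hin1.
move=> tb' htb' hbar' r c.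
have [a1' [f1' [H' [b1' [[e1' _ _ _] [_ [[_ _ sortH' _] _]]]]]]] :=
  phis_glue ca cb hto hun htb' hbar' i0 hadd.
(* Replacing [tb] exchanges barred letters for barred letters only. *)
have hu s d : unbar (ext alpha (glue alpha beta to tb') s d) = unbar (ext alpha tau s d).
  rewrite /tau !(ext_glue _ hto); case: ifP => // h.
  have hb f : (forall r c, in_shape beta r c -> barred (f r c)) ->
      unbar (f (s - (size alpha - size beta)) d) = None.
    by move=> hf; rewrite /unbar hf // in_shapeE.
  by rewrite !hb.
have [a2 [g1 [g2 [H1 [H2 [d1 d2 d3 d4]]]]]] := phis_unbar (t := i.-1) ca
  (tab_glue hto htb' hun hbar') (tab_glue hto htb hun hbar) (addable_mem hadd) hu.
have [e4 e5 e6] : [/\ a2 = a1', g1 = f1' & H1 = H'] by move: d1; rewrite e1' => -[].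
have [e7 e8 e9] : [/\ a2 = a1, g2 = f1 & H2 = H] by move: d2; rewrite e1 => -[].
subst a1' f1' H' a2 g2 H2.
have Apart_unbar g : Apart g r c = if in_skew g.1 [:: 1] r c then unbar (g.2 r c) else None.
  by rewrite /Apart /unbar; case: ifP => [/andP[-> /negbTE ->]|] //; case: in_skew => //= /negbFE ->.
rewrite !Apart_unbar eg /mu e1' (sort_rev_sorted sortH') /=; case: ifP => // hs.
have [hr|hr] := leqP r (size a1).
  have hsh : in_shape a1 r c.
    move: hs; rewrite in_skewE ?size_rcons // => /andP[c0 /andP[_ h]].
    by rewrite in_shapeE c0; move: h; rewrite rowlen_rcons ltn_eqF.
  by have := d3 r c; rewrite /ext hsh.
(* Both last rows are reversals of the exit lists, so they agree box by box after [unbar]. *)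
by rewrite !nth_unbar !map_rev d4.
Qed.
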